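(* Let $\alpha\in\overline X$. The sequence $(\alpha^H_{(n)})$ produced from $\alpha$ by J. Hurwitz's algorithm is purely periodic if and only if $\alpha$ is a quadratic irrational over $\mathbb{Q}(i)$ and $(\alpha,\alpha')\in\widetilde X$, where $\alpha'$ is the conjugate of $\alpha$ over $\mathbb{Q}(i)$.
   Context: Let $X=\{u(1+i)+v(1-i): -1/2\le u,v<1/2\}$, $\overline X$ its closure, $X^o$ its interior. For $0\le k<4$ set $L(i^k(1+i))=i^k(1+i)\mathbb{Z}_{>0}$, $L(i^k2)=\{i^k(m(1+i)+l(1-i)): m,l\in\mathbb{Z}_{>0}\}$. For $w\in(1+i)\mathbb{Z}[i]$: $Q_0=\overline X$; if $w\in L(i^k(1+i))$, $Q_w=(X^o+w)\cup\{ui^k(1+i)-\tfrac12 i^k(1-i)+w: -\tfrac12<u\le\tfrac12\}\cup\{\tfrac12 i^k(1+i)+ui^k(1-i)+w: -\tfrac12\le u\le\tfrac12\}\cup\{ui^k(1+i)+\tfrac12 i^k(1-i)+w: -\tfrac12<u\le\tfrac12\}$; if $w\in L(i^k2)$, $Q_w=(X^o+w)\cup\{ui^k(1+i)+\tfrac12 i^k(1-i)+w: -\tfrac12<u\le\tfrac12\}\cup\{\tfrac12 i^k(1+i)+ui^k(1-i)+w: -\tfrac12<u\le\tfrac12\}$. These partition $\mathbb{C}$; for $z\notin\mathbb{Z}[i]$, $\lfloor z\rfloor_H$ is the unique $w$ with $z\in Q_w$, and $\lfloor z\rfloor_H=z$ for $z\in\mathbb{Z}[i]$. $T_H(z)=1/z-\lfloor1/z\rfloor_H$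 for $z\ne0$, $T_H(0)=0$. J. Hurwitz's algorithm: $\alpha^H_{(1)}=\alpha$; if $\alpha^H_{(n)}\ne0$ then $\alpha^H_{(n+1)}=T_H(\alpha^H_{(n)})$; if $\alpha^H_{(n)}=0$ the sequence terminates. Purely periodic means the sequence is infinite and there is $l\ge1$ with $\alpha^H_{(n+l)}=\alpha^H_{(n)}$ for all $n\ge1$. For $1\le j\le4$: $X_j=\{z\in X: |z-i^{k+j-1}(1+i)/2|>\sqrt2/2\text{ for }k=0,1,2\}$, $X_{j+4}=\{z\in X: |z-i^{k+j-1}(1-i)/2|<\sqrt2/2\text{ for }k=0,1\}$, $W_j=\{z\in\mathbb{C}: |z|>1,\ |z-i^{j-1}(1-i)|\ge1\}$, $W_{j+4}=\{z\in\mathbb{C}: |z|>1,\ |z-i^{k+j-1}(1-i)|\ge1\text{ for }k=0,1\}$. $\widetilde X=\bigcup_{j=1}^4\overline{X_j}\times(W_j\cup\{\infty\})\cup\bigcup_{j=5}^8X_j\times(W_j\cup\{\infty\})$. *)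

(* Defs.v *)
From mathcomp Require Import all_boot all_order all_algebra.
From mathcomp Require Import all_classical all_reals all_analysis.
From mathcomp Require Export complex.

Set Implicit Arguments.
Unset Strict Implicit.
Unset Printing Implicit Defensive.

Import Order.TTheory GRing.Theory Num.Theory.
Import numFieldNormedType.Exports.

Local Open Scope classical_set_scope.
Local Open Scope ring_scope.
Local Open Scope complex_scope.

(* The complex plane over R. The library puts the topology of the modulus on
   the alias R[i]^o, which is convertible to R[i]. *)
Notation Cplx R := (R[i]^o).

Section Hurwitz.
Variable R : realType.

(* 'i^k (u (1 + i) + v (1 - i)) *)
Definition pt (k : nat) (u v : R) : Cplx R :=
  'i ^+ k * (u%:C * (1 + 'i) + v%:C * (1 - 'i)).

Definition squareX : set (Cplx R) :=
  [set z | exists u v : R,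
     [/\ - 2^-1 <= u < 2^-1, - 2^-1 <= v < 2^-1 & z = pt 0 u v]].

Definition gauss_int : set (Cplx R) :=
  [set z | exists m n : int, z = m%:~R + n%:~R * 'i].

(* L(i^k (1 + i)) *)
Definition L1 (k : nat) : set (Cplx R) :=
  [set w | exists2 m : nat, (0 < m)%N & w = 'i ^+ k * (1 + 'i) * m%:R].

(* L(i^k 2) *)
Definition L2 (k : nat) : set (Cplx R) :=
  [set w | exists m l : nat, [/\ (0 < m)%N, (0 < l)%N &
     w = 'i ^+ k * (m%:R * (1 + 'i) + l%:R * (1 - 'i))]].

(* Q_w for w in L(i^k (1 + i)) *)
Definition Q1 (k : nat) (w : Cplx R) : set (Cplx R) :=
  [set x + w | x in squareX°]
  `|` [set pt k u (- 2^-1) + w | u in [set u : R | - 2^-1 < u <= 2^-1]]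
  `|` [set pt k 2^-1 u + w | u in [set u : R | - 2^-1 <= u <= 2^-1]]
  `|` [set pt k u 2^-1 + w | u in [set u : R | - 2^-1 < u <= 2^-1]].

(* Q_w for w in L(i^k 2) *)
Definition Q2 (k : nat) (w : Cplx R) : set (Cplx R) :=
  [set x + w | x in squareX°]
  `|` [set pt k u 2^-1 + w | u in [set u : R | - 2^-1 < u <= 2^-1]]
  `|` [set pt k 2^-1 u + w | u in [set u : R | - 2^-1 < u <= 2^-1]].

(* For w in (1 + i)Z[i], exactly one case below applies, for exactly one k;
   for any other w the set is empty. *)
Definition Q (w : Cplx R) : set (Cplx R) :=
  [set z | [\/ w = 0 /\ closure squareX z,
     exists k, [/\ (k < 4)%N, L1 k w & Q1 k w z]
   | exists k, [/\ (k < 4)%N, L2 k w & Q2 k w z]]].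

Definition floorH (z : Cplx R) : Cplx R :=
  if `[< gauss_int z >] then z
  else xget 0 [set w | (exists2 g, gauss_int g & w = (1 + 'i) * g) /\ Q w z].

Definition TH (z : Cplx R) : Cplx R :=
  if z == 0 then 0 else z^-1 - floorH z^-1.

(* The value at n is the (n + 1)-st term of the sequence, which starts at 1;
   it is None when the sequence has terminated before that term. *)
Fixpoint hurwitz_seq (alpha : Cplx R) (n : nat) : option (Cplx R) :=
  if n is n'.+1 then
    if hurwitz_seq alpha n' is Some z then
      if z == 0 then None else Some (TH z)
    else None
  else Some alpha.

Definition purely_periodic (s : nat -> option (Cplx R)) : Prop :=
  (forall n, s n <> None) /\
  (exists2 l, (1 <= l)%N & forall n, s (n + l)%N = s n).

(* X_j, 1 <= j <= 4 *)
Definition Xa (j : nat) : set (Cplx R) :=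
  [set z | squareX z /\ forall k, (k <= 2)%N ->
     (Num.sqrt 2 / 2)%:C < `|z - 'i ^+ (k + j - 1) * (1 + 'i) / 2|].

(* X_{j+4}, 1 <= j <= 4 *)
Definition Xb (j : nat) : set (Cplx R) :=
  [set z | squareX z /\ forall k, (k <= 1)%N ->
     `|z - 'i ^+ (k + j - 1) * (1 - 'i) / 2| < (Num.sqrt 2 / 2)%:C].

(* W_j, 1 <= j <= 4 *)
Definition Wa (j : nat) : set (Cplx R) :=
  [set z | 1 < `|z| /\ 1 <= `|z - 'i ^+ (j - 1) * (1 - 'i)|].

(* W_{j+4}, 1 <= j <= 4 *)
Definition Wb (j : nat) : set (Cplx R) :=
  [set z | 1 < `|z| /\ forall k, (k <= 1)%N ->
     1 <= `|z - 'i ^+ (k + j - 1) * (1 - 'i)|].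

(* W together with the point at infinity, None *)
Definition addoo (W : set (Cplx R)) :
    set (one_point_compactification (Cplx R)) :=
  Some @` W `|` [set None].

Definition Xtilde : set (Cplx R * one_point_compactification (Cplx R)) :=
  \bigcup_(j in [set j : nat | (1 <= j <= 4)%N]) (closure (Xa j) `*` addoo (Wa j))
  `|` \bigcup_(j in [set j : nat | (1 <= j <= 4)%N]) (Xb j `*` addoo (Wb j)).

(* the field Q(i) *)
Definition Qi : set (Cplx R) :=
  [set z | exists a b : rat, z = ratr a + ratr b * 'i].

Definition quadratic_over_Qi (p : {poly R[i]}) : Prop :=
  size p = 3%N /\ forall n, Qi p`_n.

Definition quadratic_irrational (a : Cplx R) : Prop :=
  ~ Qi a /\ exists2 p : {poly R[i]}, quadratic_over_Qi p & root p a.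

(* The conjugate of a over Q(i): the other root of a quadratic polynomial over
   Q(i) that vanishes at a. Meaningful when a is a quadratic irrational, as the
   polynomial is then unique up to a constant factor. *)
Definition conjQi (a : Cplx R) : Cplx R :=
  xget 0 [set b : Cplx R | exists2 p : {poly R[i]}, quadratic_over_Qi p &
     p = lead_coef p *: (('X - a%:P) * ('X - b%:P))].

End Hurwitz.

Arguments squareX : clear implicits.
Arguments Xtilde : clear implicits.

(* Main.v *)
(* The map [T (z, w) = (1 / z - a, 1 / w - a)], with [a] the digit of [1 / z],
   preserves the set of pairs ([reduced] below), and the conditions defining that
   set make the digit of the previous step a function of the image, so [T] is
   injective on it. The conjugate of [1 / z - a] is [1 / w - a] if [w] is the
   conjugate of [z]; a quadratic irrational in the closed square is in the open
   unit disc, and the conjugate of a point on the unit circle is on it too, so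
   the strict inequality [|w| > 1] is preserved as well.

   If (alpha, alpha') is reduced, all the points of its orbit are roots of
   quadratic forms over Z[i] of the same discriminant. The forms are bounded
   whenever the point is away from the vertices of the square, and the orbit
   cannot remain near the vertices, so some value is repeated; injectivity moves
   the repetition back to alpha.

   Conversely, if alpha is purely periodic it is a fixed point of a matrix over
   Z[i] of determinant 1 or -1 whose eigenvalue at alpha, the product of the terms
   of a period, has modulus less than 1. So the second fixed point alpha' is
   attracting. The orbit of (alpha, oo) under [T] stays in the set and its second
   component converges to alpha' along the multiples of the period. *)
Require Import Defs.
From mathcomp Require Import all_boot all_order all_algebra.
From mathcomp Require Import all_classical all_reals all_analysis.
From mathcomp Require Import ring lra zify.

Import Order.TTheory GRing.Theory Num.Theory.
Import numFieldNormedType.Exports.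

Set Implicit Arguments.
Unset Strict Implicit.
Unset Printing Implicit Defensive.

Local Open Scope classical_set_scope.
Local Open Scope ring_scope.
Local Open Scope complex_scope.

(** * Coordinates on the complex plane *)

Section Plane.

Variable R : realType.
Local Notation Re := (@complex.Re R).
Local Notation Im := (@complex.Im R).
Implicit Types (z w : R[i]) (m l : int).

Lemma ReD z w : Re (z + w) = Re z + Re w. Proof. by move: z w => [a b] [c d]. Qed.
Lemma ImD z w : Im (z + w) = Im z + Im w. Proof. by move: z w => [a b] [c d]. Qed.
Lemma ReN z : Re (- z) = - Re z. Proof. by case: z. Qed.
Lemma ImN z : Im (- z) = - Im z. Proof. by case: z. Qed.
Lemma ReM z w : Re (z * w) = Re z * Re w - Im z * Im w.
Proof. by move: z w => [a b] [c d]. Qed.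
Lemma ImM z w : Im (z * w) = Re z * Im w + Im z * Re w.
Proof. by move: z w => [a b] [c d]. Qed.
Lemma Re1 : Re (1 : R[i]) = 1. Proof. by []. Qed.
Lemma Im1 : Im (1 : R[i]) = 0. Proof. by []. Qed.
Lemma Re0 : Re (0 : R[i]) = 0. Proof. by []. Qed.
Lemma Im0 : Im (0 : R[i]) = 0. Proof. by []. Qed.
Lemma ReiM z : Re ('i * z) = - Im z.
Proof. by rewrite ReM /=; ring. Qed.
Lemma ImiM z : Im ('i * z) = Re z.
Proof. by rewrite ImM /=; ring. Qed.
Lemma ReC (x : R) : Re x%:C = x. Proof. by []. Qed.
Lemma ImC (x : R) : Im x%:C = 0. Proof. by []. Qed.
Lemma intC m : (m%:~R : R[i]) = (m%:~R : R)%:C.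
Proof. by rewrite rmorph_int. Qed.
Lemma Re_int m : Re (m%:~R : R[i]) = m%:~R. Proof. by rewrite intC. Qed.
Lemma Im_int m : Im (m%:~R : R[i]) = 0. Proof. by rewrite intC. Qed.
Lemma Re_nat (n : nat) : Re (n%:R : R[i]) = n%:R.
Proof. by have -> : (n%:R : R[i]) = (n%:R : R)%:C by rewrite rmorph_nat. Qed.
Lemma Im_nat (n : nat) : Im (n%:R : R[i]) = 0.
Proof. by have -> : (n%:R : R[i]) = (n%:R : R)%:C by rewrite rmorph_nat. Qed.
Lemma Re_mk (x y : R) : Re (x +i* y) = x. Proof. by []. Qed.
Lemma Im_mk (x y : R) : Im (x +i* y) = y. Proof. by []. Qed.
Definition ReImE := (Re_mk, Im_mk, ReiM, ImiM, ReD, ImD, ReN, ImN, ReM, ImM, ReC, ImC, Re_int, Im_int,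
  Re_nat, Im_nat, Re1, Im1, Re0, Im0).

Lemma complexP z w : Re z = Re w -> Im z = Im w -> z = w.
Proof. by case: z => x y; case: w => x' y' /= -> ->. Qed.

Definition sqn z : R := Re z ^+ 2 + Im z ^+ 2.

Lemma sqn_ge0 z : 0 <= sqn z.
Proof. by rewrite addr_ge0 ?sqr_ge0. Qed.
Lemma sqn_eq0 z : (sqn z == 0) = (z == 0).
Proof.
rewrite /sqn paddr_eq0 ?sqr_ge0 // !sqrf_eq0; case: z => x y /=.
by rewrite eq_complex.
Qed.
Lemma sqn_gt0 z : (0 < sqn z) = (z != 0).
Proof. by rewrite lt_def sqn_ge0 andbT sqn_eq0. Qed.
Lemma sqnM z w : sqn (z * w) = sqn z * sqn w.
Proof. by rewrite /sqn !ReImE; ring. Qed.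
Lemma sqn1 : sqn 1 = 1. Proof. by rewrite /sqn !ReImE; ring. Qed.
Lemma sqn0 : sqn 0 = 0. Proof. by rewrite /sqn !ReImE; ring. Qed.
Lemma sqnN z : sqn (- z) = sqn z. Proof. by rewrite /sqn !ReImE; ring. Qed.
Lemma sqnV z : sqn z^-1 = (sqn z)^-1.
Proof.
have [->|z0] := eqVneq z 0; first by rewrite invr0 sqn0 invr0.
have s0 : sqn z != 0 by rewrite sqn_eq0.
by apply: (mulfI s0); rewrite -sqnM divff // divff // sqn1.
Qed.
Lemma norm_sqn z : `|z| = (Num.sqrt (sqn z))%:C.
Proof. by rewrite normc_def. Qed.
Lemma mulcJE z : z * z^*%C = (sqn z)%:C.
Proof. by case: z => x y; apply: complexP; rewrite /sqn !ReImE /=; ring. Qed.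

Lemma norm_leE z w : (`|z| <= `|w|) = (sqn z <= sqn w).
Proof. by rewrite !norm_sqn lecR ler_sqrt ?sqn_ge0. Qed.
Lemma norm_ltE z w : (`|z| < `|w|) = (sqn z < sqn w).
Proof. by rewrite !norm_sqn ltcR !ltNge ler_sqrt ?sqn_ge0. Qed.

(** Triangle inequality: [|w - c z| >= |c| |z| - |w| >= 2 |z| - |z|]. It settles every digit of
    modulus at least 2. *)
Lemma sqn_two_le z w c : 4 <= sqn c -> sqn w <= sqn z -> sqn z <= sqn (w - c * z).
Proof.
move=> c2; rewrite -!norm_leE => wz.
have cn : 2 <= `|c|.
  have <- : `|2 : R[i]| = 2 by rewrite normr_nat.
  rewrite norm_leE.
  by rewrite (le_trans _ c2) // /sqn !ReImE; lra.
rewrite distrC; apply: le_trans (lerB_dist _ _).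
rewrite lerBrDr normrM (le_trans (lerD (lexx _) wz)) //.
by rewrite -mulr2n -mulr_natl ler_wpM2r.
Qed.

(* [z = u (1 + i) + v (1 - i)] for [u = pc z / 2] and [v = qc z / 2]. *)
Definition pc z : R := Re z + Im z.
Definition qc z : R := Re z - Im z.

Lemma sqn_pq z : sqn z = (pc z ^+ 2 + qc z ^+ 2) / 2.
Proof. by rewrite /sqn /pc /qc; field. Qed.

(* [m (1 + i) + l (1 - i)] *)
Definition evenG m l : R[i] := (m + l)%:~R +i* (m - l)%:~R.

Lemma pc_ev m l : pc (evenG m l) = 2 * m%:~R.
Proof. by rewrite /pc /= rmorphB rmorphD /=; ring. Qed.
Lemma qc_ev m l : qc (evenG m l) = 2 * l%:~R.
Proof. by rewrite /qc /= rmorphB rmorphD /=; ring. Qed.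
Lemma pcB z w : pc (z - w) = pc z - pc w. Proof. by rewrite /pc !ReImE; ring. Qed.
Lemma qcB z w : qc (z - w) = qc z - qc w. Proof. by rewrite /qc !ReImE; ring. Qed.
Lemma pcD z w : pc (z + w) = pc z + pc w. Proof. by rewrite /pc !ReImE; ring. Qed.
Lemma qcD z w : qc (z + w) = qc z + qc w. Proof. by rewrite /qc !ReImE; ring. Qed.
Lemma pqP z w : pc z = pc w -> qc z = qc w -> z = w.
Proof. by rewrite /pc /qc => h1 h2; apply: complexP; lra. Qed.
Lemma ReImV z : z != 0 ->
  Re z^-1 = Re z / sqn z /\ Im z^-1 = - Im z / sqn z.
Proof.
by move=> z0; case: z z0 => x y _; split; rewrite /sqn //= mulNr.
Qed.
(** Conjugation exchanges [pc] and [qc], hence so does inversion up to the factor [1 / sqn z]. *)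
Lemma pcV z : z != 0 -> pc z^-1 = qc z / sqn z.
Proof. by move=> z0; rewrite /pc /qc; have [-> ->] := ReImV z0; ring. Qed.
Lemma qcV z : z != 0 -> qc z^-1 = pc z / sqn z.
Proof. by move=> z0; rewrite /pc /qc; have [-> ->] := ReImV z0; ring. Qed.
End Plane.

(** * Neighbourhoods and the square *)

Section Topo.
Variable R : realType.
Implicit Types (z w : R[i]).

Definition ofpq (p q : R) : R[i] := ((p + q) / 2) +i* ((p - q) / 2).
Lemma pc_ofpq p q : pc (ofpq p q) = p. Proof. by rewrite /pc /=; field. Qed.
Lemma qc_ofpq p q : qc (ofpq p q) = q. Proof. by rewrite /qc /=; field. Qed.

Lemma norm_lt_sqr (x e : R) : 0 < e -> (`|x| < e) = (x ^+ 2 < e ^+ 2).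
Proof.
move=> e0; rewrite -(real_normK (num_real x)) ltr_pXn2r // nnegrE ?normr_ge0 //.
exact: ltW.
Qed.

Lemma nbhs_pqP (z : Cplx R) (A : set (Cplx R)) :
  nbhs z A <-> exists2 e : R, 0 < e &
    forall w : Cplx R, `|pc w - pc z| < e -> `|qc w - qc z| < e -> A w.
Proof.
split=> [/nbhs_ballP[e /= e0 eA]|[e e0 eA]].
  (* The radius [e] of a ball is a complex number; [0 < e] makes its imaginary part 0. *)
  have e0' : 0 < complex.Re e by move: e0; rewrite ltcE => /andP[].
  have ee : e = (complex.Re e)%:C.
    by move: e0; rewrite ltcE => /andP[/eqP h _]; apply: complexP.
  exists (complex.Re e) => // w pw qw; apply: eA.
  rewrite -ball_normE /ball_ /= ee norm_sqn ltcR.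
  rewrite -[ltRHS]ger0_norm ?ltW // -sqrtr_sqr ltr_sqrt ?exprn_gt0 //.
  rewrite sqn_pq pcB qcB.
  by move: pw qw; rewrite !norm_lt_sqr // => pw qw; nra.
apply/nbhs_ballP; exists (e / 2)%:C => /=; first by rewrite ltcR divr_gt0.
move=> w; rewrite -ball_normE /ball_ /= norm_sqn ltcR.
have e20 : 0 < e / 2 by rewrite divr_gt0.
rewrite -[ltRHS]ger0_norm ?ltW // -sqrtr_sqr ltr_sqrt ?exprn_gt0 //.
rewrite sqn_pq pcB qcB => h.
have := sqr_ge0 (qc z - qc w); have := sqr_ge0 (pc z - pc w).
by have := sqr_ge0 e => *; apply: eA; rewrite norm_lt_sqr //; lra.
Qed.

Lemma closure_pqP (z : Cplx R) (A : set (Cplx R)) :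
  closure A z <-> forall e : R, 0 < e ->
    exists2 w : Cplx R, A w & `|pc w - pc z| < e /\ `|qc w - qc z| < e.
Proof.
split=> [zA e e0|h B /nbhs_pqP[e /h[w Aw [pw qw]] eB]].
  have /zA[w [Aw [pw qw]]] : nbhs z [set w : Cplx R | `|pc w - pc z| < e /\
      `|qc w - qc z| < e] by apply/nbhs_pqP; exists e.
  by exists w.
by exists w; split => //; exact: eB.
Qed.

Lemma squareXE (z : Cplx R) : squareX R z <-> -1 <= pc z < 1 /\ -1 <= qc z < 1.
Proof.
split=> [[u [v [hu hv ->]]]|[hp hq]].
  by rewrite /pt expr0 mul1r /pc /qc !ReImE; lra.
exists (pc z / 2), (qc z / 2); split; [lra|lra|].
rewrite /pt expr0 mul1r; apply: pqP.
  by rewrite [RHS]/pc !ReImE; field.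
by rewrite [RHS]/qc !ReImE; field.
Qed.

Lemma interior_squareXE (z : Cplx R) :
  (squareX R)° z <-> `|pc z| < 1 /\ `|qc z| < 1.
Proof.
split=> [|[hp hq]].
  move=> /nbhs_pqP[e e0 eX].
  have /squareXE[h1 h2] : squareX R z.
    by apply: eX; rewrite subrr normr0.
  have /squareXE : squareX R (ofpq (pc z - e / 2) (qc z - e / 2)).
    by apply: eX; rewrite ?pc_ofpq ?qc_ofpq ltr_norml; lra.
  by rewrite pc_ofpq qc_ofpq !ltr_norml; lra.
apply/nbhs_pqP; move: hp hq; rewrite !ltr_norml => hp hq.
exists (Num.min (Num.min (1 + pc z) (1 - pc z)) (Num.min (1 + qc z) (1 - qc z))).
  by rewrite !lt_min; lra.
move=> w; rewrite !lt_min !ltr_norml => h1 h2.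
by apply/squareXE; lra.
Qed.

Definition inX z := `|pc z| <= 1 /\ `|qc z| <= 1.

Lemma closure_squareXE (z : Cplx R) : closure (squareX R) z <-> inX z.
Proof.
split=> [/closure_pqP h|[hp hq]].
  suff H : forall e : R, 0 < e -> `|pc z| <= 1 + e /\ `|qc z| <= 1 + e.
    by split; apply/ler_addgt0Pr => e /H[].
  move=> e /h[w /squareXE[h1 h2]]; rewrite !ltr_norml !ler_norml; lra.
apply/closure_pqP => e e0.
(* [z] is shrunk towards 0 by the factor [1 - t]: both coordinates get below 1 in absolute value and
   move by at most [t < e]. *)
pose t := Num.min (e / 2) 1; have t0 : 0 < t by rewrite lt_min; lra.
have te : t <= e / 2 by rewrite ge_min lexx.
have t1 : t <= 1 by rewrite ge_min lexx orbT.
move: hp hq; rewrite !ler_norml => hp hq.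
exists (ofpq ((1 - t) * pc z) ((1 - t) * qc z)).
  by apply/squareXE; rewrite pc_ofpq qc_ofpq; nra.
rewrite pc_ofpq qc_ofpq !ltr_norml; nra.
Qed.
End Topo.

(** * The digits *)

Section Digits.
Variable R : realType.
Implicit Types (z w : R[i]) (m l : int).

(* [2 m] is an even integer nearest to [p], the one closer to 0 in case of a tie. *)
Definition round2 (p : R) m : Prop :=
  [/\ `|p - 2 * m%:~R| <= 1, 1 <= m -> 2 * m%:~R - 1 < p
    & m <= -1 -> p < 2 * m%:~R + 1].

(** The tie rules of the sets [Q w] act on each diagonal coordinate separately, so a digit is a pair
    of independent roundings. *)
Definition digit z m l := round2 (pc z) m /\ round2 (qc z) l.

Lemma round2_ex (p : R) : exists m, round2 p m.
Proof.
(* The ceiling sends ties down and the floor sends them up, in both cases towards 0. *)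
have [p0|p0] := leP 0 p.
  exists (Num.ceil ((p - 1) / 2)); set m := Num.ceil _.
  have h1 : (p - 1) / 2 <= m%:~R by exact: Num.Theory.ceil_ge.
  have h2 : m%:~R < (p - 1) / 2 + 1.
    by rewrite -ltrBlDr -(intrB _ m 1) Num.Theory.ceilB1_lt.
  split; [by rewrite ler_norml; lra|lra|move=> m1].
  have : (m%:~R : R) <= -1 by rewrite (_ : -1 = (-1)%:~R) // ler_int.
  lra.
exists (Num.floor ((p + 1) / 2)); set m := Num.floor _.
have h1 : m%:~R <= (p + 1) / 2 by exact: Num.Theory.floor_le.
have h2 : (p + 1) / 2 < m%:~R + 1.
  by rewrite -(intrD _ m 1); exact: Num.Theory.floorD1_gt.
split; [by rewrite ler_norml; lra|move=> m1|lra].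
have : (1 : R) <= m%:~R by rewrite (_ : 1 = 1%:~R) // ler_int.
lra.
Qed.

Lemma pc_pt0 (u v : R) : pc (pt 0 u v) = 2 * u.
Proof. by rewrite /pt expr0 mul1r /pc !ReImE; ring. Qed.
Lemma qc_pt0 (u v : R) : qc (pt 0 u v) = 2 * v.
Proof. by rewrite /pt expr0 mul1r /qc !ReImE; ring. Qed.
Lemma pcMi z : pc ('i * z) = qc z.
Proof. by rewrite /pc /qc !ReImE; ring. Qed.
Lemma qcMi z : qc ('i * z) = - pc z.
Proof. by rewrite /pc /qc !ReImE; ring. Qed.
Lemma pc_ptS k (u v : R) : pc (pt k.+1 u v) = qc (pt k u v).
Proof. by rewrite -pcMi /pt exprS mulrA. Qed.
Lemma qc_ptS k (u v : R) : qc (pt k.+1 u v) = - pc (pt k u v).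
Proof. by rewrite -qcMi /pt exprS mulrA. Qed.
Definition pqptE := (pc_pt0, qc_pt0, pc_ptS, qc_ptS).

Lemma pt_ex k z : exists u v : R, z = pt k u v.
Proof.
elim: k z => [z|k IH z].
  by exists (pc z / 2), (qc z / 2); apply: pqP; rewrite pqptE; field.
have [u [v h]] := IH (- 'i * z).
exists u, v; apply: pqP; rewrite pqptE -h mulNr.
  by rewrite /qc /pc !ReImE; ring.
by rewrite /qc /pc !ReImE; ring.
Qed.

Lemma interior_squareX_pt k (u v : R) : (k < 4)%N ->
  (squareX R)° (pt k u v) <-> `|u| < 2^-1 /\ `|v| < 2^-1.
Proof.
move=> k4; apply: (iff_trans (interior_squareXE _)).
case: k k4 => [|[|[|[|//]]]] _; rewrite !pqptE !ltr_norml; split; lra.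
Qed.

(** In the rotated coordinates the open square with its three edges is a box that lacks only the
    side [u = - 1 / 2]. *)
Lemma Q1E k w z : (k < 4)%N -> Q1 k w z <->
  exists u v : R, [/\ z = pt k u v + w, - 2^-1 < u <= 2^-1 & - 2^-1 <= v <= 2^-1].
Proof.
move=> k4; split=> [[[[|]|]|]|[u [v [-> hu hv]]]].
- move=> [x]; have [u [v ->]] := pt_ex k x.
  move=> /(interior_squareX_pt _ _ k4)[]; rewrite !ltr_norml => hu hv <-.
  by exists u, v; split => //; lra.
- by move=> [u /= hu <-]; exists u, (- 2^-1); split => //; lra.
- by move=> [u /= hu <-]; exists 2^-1, u; split => //; lra.
- by move=> [u /= hu <-]; exists u, 2^-1; split => //; lra.
have [->|nv1] := eqVneq v (- 2^-1); first by left; left; right; exists u.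
have [->|nv2] := eqVneq v 2^-1; first by right; exists u.
have [->|nu] := eqVneq u 2^-1; first by left; right; exists v.
left; left; left; exists (pt k u v) => //; apply/interior_squareX_pt => //.
move/eqP: nv1; move/eqP: nv2; move/eqP: nu; rewrite !ltr_norml; lra.
Qed.

Lemma Q2E k w z : (k < 4)%N -> Q2 k w z <->
  exists u v : R, [/\ z = pt k u v + w, - 2^-1 < u <= 2^-1 & - 2^-1 < v <= 2^-1].
Proof.
move=> k4; split=> [[[|]|]|[u [v [-> hu hv]]]].
- move=> [x]; have [u [v ->]] := pt_ex k x.
  move=> /(interior_squareX_pt _ _ k4)[]; rewrite !ltr_norml => hu hv <-.
  by exists u, v; split => //; lra.
- by move=> [u /= hu <-]; exists u, 2^-1; split => //; lra.
- by move=> [u /= hu <-]; exists 2^-1, u; split => //; lra.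
have [->|nv2] := eqVneq v 2^-1; first by left; right; exists u.
have [->|nu] := eqVneq u 2^-1; first by right; exists v.
left; left; exists (pt k u v) => //; apply/interior_squareX_pt => //.
move/eqP: nv2; move/eqP: nu; rewrite !ltr_norml; lra.
Qed.

Lemma L1E k w : L1 k w <-> exists2 n : nat, (0 < n)%N & w = pt k n%:R 0.
Proof.
have E (n : nat) : pt k n%:R 0 = 'i ^+ k * (1 + 'i) * n%:R :> R[i].
  by rewrite /pt rmorph0 rmorph_nat; ring.
by split=> -[n n0 ->]; exists n.
Qed.

Lemma L2E k w : L2 k w <->
  exists m l : nat, [/\ (0 < m)%N, (0 < l)%N & w = pt k m%:R l%:R].
Proof.
have E (m l : nat) : pt k m%:R l%:R =
    'i ^+ k * (m%:R * (1 + 'i) + l%:R * (1 - 'i)) :> R[i].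
  by rewrite /pt !rmorph_nat.
by split=> -[m [l [m0 l0 ->]]]; exists m, l.
Qed.

Lemma pt_even k (m l : nat) : (k < 4)%N ->
  pt k m%:R l%:R = nth 0 [:: evenG R m l; evenG R l (- m%:Z);
    evenG R (- m%:Z) (- l%:Z); evenG R (- l%:Z) m] k.
Proof.
by case: k => [|[|[|[|//]]]] _ /=; apply: pqP;
  rewrite !pqptE ?pc_ev ?qc_ev ?mulrNz ?pmulrn //; ring.
Qed.

(** Elements of [L1] have one nonzero coordinate among [m], [l], those of [L2] have two. The signs
    are fixed by [k], and they decide which sides of the box are open. *)
Lemma Q_digit w z : Q w z -> exists m l, w = evenG R m l /\ digit z m l.
Proof.
case=> [[-> /closure_squareXE[pz qz]]|[k [k4 /L1E[m m0 ->] /(Q1E _ _ k4)]]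
    |[k [k4 /L2E[m [l [m0 l0 ->]]] /(Q2E _ _ k4)]]].
- exists 0, 0; split; first by [].
  by split; split => //; rewrite mulr0 subr0.
- move=> [u [v [-> hu hv]]].
  have {m0} : (1 : R) <= m%:R by rewrite ler1n.
  rewrite -[0]/(0%:R); case: k k4 => [|[|[|[|//]]]] k4; rewrite pt_even //= => m1.
  + exists m, 0%N; split=> //; split; rewrite ?pcD ?qcD ?pc_ev ?qc_ev !pqptE;
     split; rewrite ?ler_norml -?pmulrn; lia || lra.
  + exists 0%N, (- m%:Z); split=> //; split; rewrite ?pcD ?qcD ?pc_ev ?qc_ev !pqptE;
     split; rewrite ?ler_norml ?mulrNz -?pmulrn; lia || lra.
  + exists (- m%:Z), (- 0%:Z); split=> //; split; rewrite ?pcD ?qcD ?pc_ev ?qc_ev !pqptE;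
     split; rewrite ?ler_norml ?mulrNz -?pmulrn; lia || lra.
  + exists (- 0%:Z), m; split=> //; split; rewrite ?pcD ?qcD ?pc_ev ?qc_ev !pqptE;
     split; rewrite ?ler_norml ?mulrNz -?pmulrn; lia || lra.
move=> [u [v [-> hu hv]]].
have {m0} : (1 : R) <= m%:R by rewrite ler1n.
have {l0} : (1 : R) <= l%:R by rewrite ler1n.
case: k k4 => [|[|[|[|//]]]] k4; rewrite pt_even //= => l1 m1.
+ exists m, l; split=> //; split; rewrite ?pcD ?qcD ?pc_ev ?qc_ev !pqptE;
   split; rewrite ?ler_norml -?pmulrn; lia || lra.
+ exists l, (- m%:Z); split=> //; split; rewrite ?pcD ?qcD ?pc_ev ?qc_ev !pqptE;
   split; rewrite ?ler_norml ?mulrNz -?pmulrn; lia || lra.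
+ exists (- m%:Z), (- l%:Z); split=> //; split; rewrite ?pcD ?qcD ?pc_ev ?qc_ev !pqptE;
   split; rewrite ?ler_norml ?mulrNz -?pmulrn; lia || lra.
+ exists (- l%:Z), m; split=> //; split; rewrite ?pcD ?qcD ?pc_ev ?qc_ev !pqptE;
   split; rewrite ?ler_norml ?mulrNz -?pmulrn; lia || lra.
Qed.
End Digits.

(** * From roundings back to the sets [Q w] *)

Section DigitQ.
Variable R : realType.
Implicit Types (z w : R[i]) (m l : int).

Lemma int_sgP m : [\/ m = 0, exists2 n : nat, (0 < n)%N & m = n%:Z
  | exists2 n : nat, (0 < n)%N & m = - n%:Z].
Proof.
case: m => [[|n]|n]; first by constructor 1.
  by constructor 2; exists n.+1.
by constructor 3; exists n.+1.
Qed.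

Lemma round2_pos (p : R) (n : nat) : (0 < n)%N -> round2 p n%:Z ->
  - 1 < p - 2 * n%:R <= 1.
Proof.
move=> n0 [+ h _]; have /h : (1 : int) <= n%:Z by lia.
by rewrite ler_norml -pmulrn; lra.
Qed.

Lemma round2_neg (p : R) (n : nat) : (0 < n)%N -> round2 p (- n%:Z) ->
  - 1 <= p + 2 * n%:R < 1.
Proof.
move=> n0 [+ _ h]; have /h : - n%:Z <= -1 by lia.
by rewrite ler_norml mulrNz -pmulrn; lra.
Qed.

Lemma round2_0 (p : R) : round2 p 0 -> - 1 <= p <= 1.
Proof. by case; rewrite mulr0 subr0 ler_norml. Qed.

Lemma Q1I k (n : nat) z : (k < 4)%N -> (0 < n)%N ->
  (forall u v : R, z = pt k u v + pt k n%:R 0 ->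
    - 2^-1 < u <= 2^-1 /\ - 2^-1 <= v <= 2^-1) -> Q (pt k n%:R 0) z.
Proof.
move=> k4 n0 h; constructor 2; exists k; split => //.
  by apply/L1E; exists n.
apply/Q1E => //; have [u [v uv]] := pt_ex k (z - pt k n%:R 0).
have e : z = pt k u v + pt k n%:R 0 by rewrite -uv subrK.
by exists u, v; have [] := h _ _ e; split.
Qed.

Lemma Q2I k (n j : nat) z : (k < 4)%N -> (0 < n)%N -> (0 < j)%N ->
  (forall u v : R, z = pt k u v + pt k n%:R j%:R ->
    - 2^-1 < u <= 2^-1 /\ - 2^-1 < v <= 2^-1) -> Q (pt k n%:R j%:R) z.
Proof.
move=> k4 n0 j0 h; constructor 3; exists k; split => //.
  by apply/L2E; exists n, j.
apply/Q2E => //; have [u [v uv]] := pt_ex k (z - pt k n%:R j%:R).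
have e : z = pt k u v + pt k n%:R j%:R by rewrite -uv subrK.
by exists u, v; have [] := h _ _ e; split.
Qed.

(** The nine sign patterns of [(m, l)] are the origin, the four half-axes ([L1]) and the four open
    quadrants ([L2]). *)
Lemma digit_Q z m l : digit z m l -> Q (evenG R m l) z.
Proof.
move=> [].
case: (int_sgP m) (int_sgP l) => [->|[n n0 ->]|[n n0 ->]]
  [->|[j j0 ->]|[j j0 ->]].
- move=> /round2_0 hp /round2_0 hq; constructor 1; split; first by [].
  by apply/closure_squareXE; split; rewrite ler_norml.
- move=> /round2_0 hp /(round2_pos j0) hq.
  have /= <- := @pt_even R 3 j 0 isT.
  by apply: Q1I => // u v e; move: hp hq; rewrite e pcD qcD !pqptE; lra.
- move=> /round2_0 hp /(round2_neg j0) hq.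
  have /= <- := @pt_even R 1 j 0 isT.
  by apply: Q1I => // u v e; move: hp hq; rewrite e pcD qcD !pqptE; lra.
- move=> /(round2_pos n0) hp /round2_0 hq.
  have /= <- := @pt_even R 0 n 0 isT.
  by apply: Q1I => // u v e; move: hp hq; rewrite e pcD qcD !pqptE; lra.
- move=> /(round2_pos n0) hp /(round2_pos j0) hq.
  have /= <- := @pt_even R 0 n j isT.
  by apply: Q2I => // u v e; move: hp hq; rewrite e pcD qcD !pqptE; lra.
- move=> /(round2_pos n0) hp /(round2_neg j0) hq.
  have /= <- := @pt_even R 1 j n isT.
  by apply: Q2I => // u v e; move: hp hq; rewrite e pcD qcD !pqptE; lra.
- move=> /(round2_neg n0) hp /round2_0 hq.
  have /= <- := @pt_even R 2 n 0 isT.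
  by apply: Q1I => // u v e; move: hp hq; rewrite e pcD qcD !pqptE; lra.
- move=> /(round2_neg n0) hp /(round2_pos j0) hq.
  have /= <- := @pt_even R 3 j n isT.
  by apply: Q2I => // u v e; move: hp hq; rewrite e pcD qcD !pqptE; lra.
move=> /(round2_neg n0) hp /(round2_neg j0) hq.
have /= <- := @pt_even R 2 n j isT.
by apply: Q2I => // u v e; move: hp hq; rewrite e pcD qcD !pqptE; lra.
Qed.

Lemma evenG_mul1i m l :
  exists2 g : Cplx R, gauss_int g & evenG R m l = (1 + 'i) * g.
Proof.
exists (m%:~R + (- l)%:~R * 'i); first by exists m, (- l).
by apply: complexP; rewrite !ReImE ?rmorphB ?rmorphD ?mulrNz; ring.
Qed.

Lemma floorHP z : ~ gauss_int z ->
  exists m l, floorH z = evenG R m l /\ digit z m l.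
Proof.
move=> /asboolPn nz; rewrite /floorH (negbTE nz).
case: xgetP => [w _ [_ /Q_digit//]|no].
(* The default value of [xget] is never taken, as rounding both coordinates gives a digit. *)
have [m hm] := round2_ex (pc z); have [l hl] := round2_ex (qc z).
by case: (no (evenG R m l)); split; [exact: evenG_mul1i|exact: digit_Q].
Qed.
End DigitQ.

(** * The natural extension *)

Section Geometry.
Variable R : realType.
Implicit Types (z w A C : R[i]) (m l M L : int).

(** The elements [1 + 'i], [- 1 - 'i], [1 - 'i], [- 1 + 'i], of modulus sqrt 2, are called units
    below. Every other nonzero element of [(1 + 'i) Z[i]] has modulus at least 2. *)
Definition units4 : seq (int * int) := [:: (1, 0); (-1, 0); (0, 1); (0, -1)].

Lemma units4P M L : (M, L) \in units4 ->
  [\/ M = 1 /\ L = 0, M = -1 /\ L = 0, M = 0 /\ L = 1 | M = 0 /\ L = -1].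
Proof.
rewrite !inE !xpair_eqE => /or4P[] /andP[/eqP-> /eqP->].
- by constructor 1.
- by constructor 2.
- by constructor 3.
by constructor 4.
Qed.

Lemma sqn_ev M L : sqn (evenG R M L) = 2 * (M ^+ 2 + L ^+ 2)%:~R.
Proof. by rewrite sqn_pq pc_ev qc_ev rmorphD !rmorphXn /=; field. Qed.

Lemma sqn_ev_ge4 M L : (M, L) != (0, 0) -> (M, L) \notin units4 ->
  4 <= sqn (evenG R M L).
Proof.
rewrite !inE !xpair_eqE => h1 h2; rewrite sqn_ev.
have : 2 <= M ^+ 2 + L ^+ 2 by nia.
by rewrite -(ler_int R) => h; lra.
Qed.

(* The second point is [w = A / C], with [C = 0] for the point at infinity. The
   condition reads: [|w| >= 1], and [|w - c| >= 1] for each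
   [c] in [{1 + i, 1 - i, - 1 - i, - 1 + i}] such that [|z - c / 2| < sqrt 2 / 2]. *)
Definition reduced z A C := sqn C <= sqn A /\ forall M L, (M, L) \in units4 ->
  sqn z < M%:~R * pc z + L%:~R * qc z -> sqn C <= sqn (A - evenG R M L * C).

(** Inversion maps the unit circle about [d = evenG L M] to the one about its conjugate [evenG M L].
    As [|d|^2 = 2], the left inequality reads [2 Re (A conj (d C)) <= |A|^2 + |C|^2], and so does
    the inequality on the right with the conjugate moved. *)
Lemma sqn_unit_swap M L A C : (M, L) \in units4 ->
  (sqn C <= sqn (A - evenG R L M * C)) = (sqn A <= sqn (C - evenG R M L * A)).
Proof.
move=> /units4P h.
suff E : sqn (A - evenG R L M * C) - sqn C = sqn (C - evenG R M L * A) - sqn A.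
  by rewrite -subr_ge0 E subr_ge0.
rewrite /sqn !ReImE !rmorphB !rmorphD /=.
by case: h => -[-> ->]; rewrite ?mulrNz; ring.
Qed.

(** For [w = A / C] and [e = evenG M L] this is [|1 / w - e| >= 1]. If [|e| >= 2] it follows from
    [|1 / w| <= 1]; if [e] is a unit it is the inverted disc condition, since [pcV] and [qcV] turn
    the last hypothesis into membership of [z] in the disc. *)
Lemma reduced_far z A C M L : z != 0 -> reduced z A C -> (M, L) != (0, 0) ->
  ((M, L) \in units4 -> 1 < M%:~R * pc z^-1 + L%:~R * qc z^-1) ->
  sqn A <= sqn (C - evenG R M L * A).
Proof.
move=> z0 [CA inv] nz hu.
have [u|nu] := boolP ((M, L) \in units4); last first.
  by apply: sqn_two_le CA; exact: sqn_ev_ge4.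
rewrite -sqn_unit_swap //; apply: inv.
  by move/units4P: u => -[] [-> ->].
have := hu u; rewrite pcV // qcV // !mulrA -mulrDl ltr_pdivlMr ?sqn_gt0 //.
by rewrite mul1r addrC.
Qed.

(** The tie rule is what makes these inequalities strict. *)
Lemma round2_gt1 (p : R) m : round2 p m -> (1 <= m -> 1 < p) /\ (m <= -1 -> p < -1).
Proof.
move=> [_ h1 h2]; split=> hm.
  have := h1 hm; have : (1 : R) <= m%:~R by rewrite -(ler_int R) in hm.
  lra.
have := h2 hm; have : (m%:~R : R) <= -1 by rewrite -(ler_int R) in hm.
lra.
Qed.

(** Inversion maps the half planes beyond the four sides to the open discs of radius sqrt 2 / 2
    about the halves of the units, so [z^-1] avoids these discs. *)
Lemma inX_inv z : z != 0 -> inX z ->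
  `|pc z^-1| <= sqn z^-1 /\ `|qc z^-1| <= sqn z^-1.
Proof.
move=> z0 [pz qz]; have s0 : 0 < sqn z by rewrite sqn_gt0.
rewrite pcV // qcV // sqnV !normrM normfV (gtr0_norm s0).
by split; rewrite ler_pdivrMr // mulVf // gt_eqF.
Qed.

Lemma digit_inX z m l : digit z m l -> inX (z - evenG R m l).
Proof. by move=> [[h _ _] [h' _ _]]; split; rewrite ?pcB ?qcB ?pc_ev ?qc_ev. Qed.

Lemma inX_sqn z : inX z -> sqn z <= 1.
Proof.
move=> [].
rewrite !ler_norml sqn_pq => /andP[h1 h2] /andP[h3 h4].
have : 0 <= (1 - pc z) * (1 + pc z) by apply: mulr_ge0; lra.
have : 0 <= (1 - qc z) * (1 + qc z) by apply: mulr_ge0; lra.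
lra.
Qed.

(** With [e] the digit, each condition on the new point [1 / w - e] has the form
    [|1 / w - (e + c)| >= 1], with [c] zero or a unit, and comes from [reduced_far]. *)
Lemma reduced_step z A C m l : z != 0 -> inX z -> sqn z < 1 -> digit z^-1 m l ->
  reduced z A C -> reduced (z^-1 - evenG R m l) (C - evenG R m l * A) A.
Proof.
move=> z0 zX z1 zml inv; have [hp hq] := inX_inv z0 zX.
have [/round2_gt1[hm hm'] /round2_gt1[hl hl']] := zml.
have ml0 : (m, l) != (0, 0).
  apply/eqP => -[m0 l0]; have /inX_sqn := digit_inX zml.
  rewrite m0 l0 [evenG _ _ _](_ : _ = 0) // subr0 sqnV invf_le1 ?sqn_gt0 //.
  by rewrite leNgt z1.
have C1 : m <> 0 \/ l <> 0 by move: ml0; rewrite xpair_eqE; lia.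
split.
  apply: reduced_far inv _ _ => // /units4P[][mE lE]; rewrite mE lE.
  - have := hm ltac:(clear -mE; lia); lra.
  - have := hm' ltac:(clear -mE; lia); lra.
  - have := hl ltac:(clear -lE; lia); lra.
  - have := hl' ltac:(clear -lE; lia); lra.
move=> M L uML hlt.
have -> : C - evenG R m l * A - evenG R M L * A = C - evenG R (m + M) (l + L) * A.
  by apply: complexP; rewrite !ReImE !rmorphB !rmorphD /=; ring.
apply: reduced_far inv _ _ => //.
  (* If the digit were [- c], then [z^-1] would lie in a disc excluded by [inX_inv]. *)
  apply/eqP => -[/eqP+ /eqP+]; rewrite !addr_eq0 => /eqP mE /eqP lE.
  move: hp hq hlt; rewrite !sqn_pq !pcB !qcB !pc_ev !qc_ev !ler_norml mE lE.
  have [i1 i0 iN1] : [/\ 1%:~R = 1 :> R, 0%:~R = 0 :> R & (-1)%:~R = -1 :> R] by [].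
  case: (units4P uML) => -[-> ->]; rewrite ?opprK ?oppr0 ?i1 ?i0 ?iN1 => h1 h2 h3.
  - by clear -h1 h3; lra.
  - by clear -h1 h3; lra.
  - by clear -h2 h3; lra.
  by clear -h2 h3; lra.
(* Here [e + c] is a unit while [e] is nonzero, so the nonzero coordinate of [e + c] has the same
   sign in [e]. *)
have hML : (M = 1 /\ L = 0 \/ M = -1 /\ L = 0) \/
    (M = 0 /\ L = 1 \/ M = 0 /\ L = -1) by case: (units4P uML); tauto.
move=> /units4P[][mE lE]; rewrite mE lE.
- have := hm ltac:(clear -mE lE C1 hML; lia); lra.
- have := hm' ltac:(clear -mE lE C1 hML; lia); lra.
- have := hl ltac:(clear -mE lE C1 hML; lia); lra.
- have := hl' ltac:(clear -mE lE C1 hML; lia); lra.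
Qed.

Lemma reduced_far1 z w M L : z != 0 -> w != 0 -> reduced z w 1 -> (M, L) != (0, 0) ->
  ((M, L) \in units4 -> 1 < M%:~R * pc z^-1 + L%:~R * qc z^-1) ->
  1 <= sqn (w^-1 - evenG R M L).
Proof.
move=> z0 w0 inv ML hu.
have : sqn w * sqn w^-1 <= sqn (1 - evenG R M L * w) * sqn w^-1.
  by rewrite ler_pM2r ?sqn_gt0 ?invr_eq0 //; exact: (reduced_far z0 inv ML hu).
by rewrite -!sqnM divff // sqn1 mulrBl mul1r mulfK.
Qed.

(** If the digits differ by [e], then [1 / w] and [1 / w'] lie in the open unit disc and differ by
    [e], against [reduced_far1]. When [e] is a unit, that lemma applies to the pair whose digit is
    farther from 0 in the coordinate that changes, as this coordinate of the inverse exceeds 1 in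
    absolute value. *)
Lemma digit_inj z w z' w' m l m' l' : z != 0 -> z' != 0 ->
  1 < sqn w -> 1 < sqn w' -> reduced z w 1 -> reduced z' w' 1 ->
  digit z^-1 m l -> digit z'^-1 m' l' ->
  z^-1 - evenG R m l = z'^-1 - evenG R m' l' ->
  w^-1 - evenG R m l = w'^-1 - evenG R m' l' -> (m, l) = (m', l').
Proof.
move=> z0 z0' w1 w1' inv inv' d d' eZ eV.
have w0 : w != 0 by rewrite -sqn_gt0 (lt_trans _ w1).
have w0' : w' != 0 by rewrite -sqn_gt0 (lt_trans _ w1').
have V1 : sqn w^-1 < 1 by rewrite sqnV invf_lt1 // (lt_trans _ w1).
have V1' : sqn w'^-1 < 1 by rewrite sqnV invf_lt1 // (lt_trans _ w1').
apply/eqP/negPn/negP => ne.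
have eV1 : w^-1 = w'^-1 - evenG R (m' - m) (l' - l).
  rewrite -[LHS](subrK (evenG R m l)) eV.
  by apply: complexP; rewrite !ReImE !(rmorphB, rmorphD) /=; ring.
have eV2 : w'^-1 = w^-1 - evenG R (m - m') (l - l').
  rewrite eV1.
  by apply: complexP; rewrite !ReImE !(rmorphB, rmorphD) /=; ring.
have ne1 : (m' - m, l' - l) != (0, 0) by move: ne; rewrite !xpair_eqE; lia.
have ne2 : (m - m', l - l') != (0, 0) by move: ne; rewrite !xpair_eqE; lia.
have no1 : ~ ((m' - m, l' - l) \in units4 ->
    1 < (m' - m)%:~R * pc z'^-1 + (l' - l)%:~R * qc z'^-1).
  by move=> h; have := reduced_far1 z0' w0' inv' ne1 h; rewrite -eV1 leNgt V1.
have no2 : ~ ((m - m', l - l') \in units4 ->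
    1 < (m - m')%:~R * pc z^-1 + (l - l')%:~R * qc z^-1).
  by move=> h; have := reduced_far1 z0 w0 inv ne2 h; rewrite -eV2 leNgt V1'.
have [/round2_gt1[hm hm'] /round2_gt1[hl hl']] := d.
have [/round2_gt1[km km'] /round2_gt1[kl kl']] := d'.
have [u|nu] := boolP ((m' - m, l' - l) \in units4); last first.
  by apply: no1 => u; rewrite u in nu.
case: (units4P u) => -[e1 e2].
- have [s|s] : 1 <= m' \/ m <= -1 by clear -e1 e2; lia.
    by apply: no1 => _; rewrite e1 e2; have := km s; lra.
  apply: no2 => _; have := hm' s.
  by rewrite -(opprB m') -(opprB l') e1 e2 ?mulrNz; lra.
- have [s|s] : 1 <= m \/ m' <= -1 by clear -e1 e2; lia.
    apply: no2 => _; have := hm s.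
    by rewrite -(opprB m') -(opprB l') e1 e2 ?mulrNz; lra.
  by apply: no1 => _; rewrite e1 e2; have := km' s; lra.
- have [s|s] : 1 <= l' \/ l <= -1 by clear -e1 e2; lia.
    by apply: no1 => _; rewrite e1 e2; have := kl s; lra.
  apply: no2 => _; have := hl' s.
  by rewrite -(opprB m') -(opprB l') e1 e2 ?mulrNz; lra.
have [s|s] : 1 <= l \/ l' <= -1 by clear -e1 e2; lia.
  apply: no2 => _; have := hl s.
  by rewrite -(opprB m') -(opprB l') e1 e2 ?mulrNz; lra.
by apply: no1 => _; rewrite e1 e2; have := kl' s; lra.
Qed.
End Geometry.

(** * Conjugation over Q(i) *)

Section Conj.
Variable R : realType.
Local Notation Re := (@complex.Re R).
Local Notation Im := (@complex.Im R).
Implicit Types (z w s p a b c g x y : R[i]) (m l : int).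

Lemma QiP z : Qi z <-> exists s t : rat, Re z = ratr s /\ Im z = ratr t.
Proof.
have E (r : rat) : (ratr r : R[i]) = (ratr r : R)%:C by rewrite fmorph_rat.
split=> -[s [t]].
  by move=> ->; exists s, t; rewrite !E !ReImE; split; ring.
by move=> [h1 h2]; exists s, t; apply: complexP; rewrite !E !ReImE ?h1 ?h2; ring.
Qed.

Lemma QiD z w : Qi z -> Qi w -> Qi (z + w).
Proof.
move=> /QiP[s [t [h1 h2]]] /QiP[s' [t' [h3 h4]]]; apply/QiP.
by exists (s + s'), (t + t'); rewrite !ReImE !rmorphD /= h1 h2 h3 h4.
Qed.
Lemma QiN z : Qi z -> Qi (- z).
Proof.
move=> /QiP[s [t [h1 h2]]]; apply/QiP.
by exists (- s), (- t); rewrite !ReImE !rmorphN /= h1 h2.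
Qed.
Lemma QiB z w : Qi z -> Qi w -> Qi (z - w).
Proof. by move=> hz hw; exact: QiD hz (QiN hw). Qed.
Lemma QiM z w : Qi z -> Qi w -> Qi (z * w).
Proof.
move=> /QiP[s [t [h1 h2]]] /QiP[s' [t' [h3 h4]]]; apply/QiP.
exists (s * s' - t * t'), (s * t' + t * s').
by rewrite !ReImE rmorphB rmorphD !rmorphM /= h1 h2 h3 h4.
Qed.
Lemma QiV z : Qi z -> Qi z^-1.
Proof.
have [->|z0] := eqVneq z 0; first by rewrite invr0.
move=> /QiP[s [t [h1 h2]]]; apply/QiP.
exists (s / (s ^+ 2 + t ^+ 2)), (- t / (s ^+ 2 + t ^+ 2)).
have [-> ->] := ReImV z0; rewrite /sqn h1 h2.
by rewrite !fmorph_div rmorphN !rmorphD !rmorphXn.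
Qed.
Lemma Qi_div z w : Qi z -> Qi w -> Qi (z / w).
Proof. by move=> hz hw; exact: QiM hz (QiV hw). Qed.
Lemma Qi_conj z : Qi z -> Qi z^*%C.
Proof.
move=> /QiP[s [t [h1 h2]]]; apply/QiP; exists s, (- t).
by case: z h1 h2 => u v /= -> ->; rewrite rmorphN.
Qed.
Lemma gauss_Qi z : gauss_int z -> Qi z.
Proof.
move=> [m [n ->]]; apply/QiP; exists m%:~R, n%:~R.
by rewrite !ReImE !ratr_int; split; ring.
Qed.
Lemma Qi_ev m l : Qi (evenG R m l).
Proof. by apply/QiP; exists (m + l)%:~R, (m - l)%:~R; rewrite !ratr_int. Qed.
Lemma Qi1 : Qi (1 : R[i]).
Proof. by apply/QiP; exists 1, 0; rewrite rmorph1 rmorph0. Qed.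
Lemma Qi0 : Qi (0 : R[i]).
Proof. by apply/QiP; exists 0, 0; rewrite rmorph0. Qed.

Lemma Qi_indep a x y : ~ Qi a -> Qi x -> Qi y -> x * a = y -> x = 0 /\ y = 0.
Proof.
move=> na Qx Qy e; have [x0|x0] := eqVneq x 0.
  by rewrite -e x0 mul0r.
by case: na; rewrite -(mulKf x0 a) e mulrC; exact: Qi_div.
Qed.

(** A relational form of [conjQi] without polynomials; [conjpair_quadratic] and [quadratic_conjpair]
    relate the two. *)
Definition conjpair a b := [/\ ~ Qi a, Qi (a + b) & Qi (a * b)].

Lemma conjpair_sym a b : conjpair a b -> conjpair b a.
Proof.
move=> [na hs hp]; split; rewrite ?[b + a]addrC ?[b * a]mulrC // => Qb.
by apply: na; rewrite -(addrK b a); exact: QiB.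
Qed.

Lemma conjpair_sub g a b : Qi g -> conjpair a b -> conjpair (a - g) (b - g).
Proof.
move=> Qg [na hs hp]; split.
- by move=> h; apply: na; rewrite -(subrK g a); exact: QiD.
- by rewrite (_ : _ + _ = a + b - (g + g)); [apply/QiB/QiD|ring].
rewrite (_ : _ * _ = a * b - g * (a + b) + g * g); last by ring.
by apply: QiD; [apply: QiB => //|]; exact: QiM.
Qed.

Lemma Qi_neq0 a : ~ Qi a -> a != 0.
Proof. by move=> na; apply/eqP => a0; apply: na; rewrite a0; exact: Qi0. Qed.

Lemma conjpair_inv a b : conjpair a b -> conjpair a^-1 b^-1.
Proof.
move=> cp; have [nb _ _] := conjpair_sym cp; have [na hs hp] := cp.
have a0 := Qi_neq0 na; have b0 := Qi_neq0 nb.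
split.
- by move=> /QiV; rewrite invrK.
- by rewrite (_ : _ + _ = (a + b) / (a * b)); [exact: Qi_div|field; rewrite ?a0 ?b0].
by rewrite -invfM; exact: QiV.
Qed.

Lemma conjpair_uniq a b b' : conjpair a b -> conjpair a b' -> b = b'.
Proof.
move=> [na hs hp] [_ hs' hp']; apply/eqP; rewrite -subr_eq0; apply/eqP.
apply: (proj1 (@Qi_indep a _ (a * b - a * b') na _ _ _)).
- by rewrite (_ : b - b' = (a + b) - (a + b')); [exact: QiB|ring].
- exact: QiB.
by ring.
Qed.

(** Substituting [a^2 = (a + b) a - a b] leaves a linear relation, whose coefficients vanish because
    1 and [a] are independent over Q(i). *)
Lemma conjpair_quad a b x y z : conjpair a b -> Qi x -> Qi y -> Qi z ->
  x * a ^+ 2 + y * a + z = 0 -> x * (a + b) = - y /\ x * (a * b) = z.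
Proof.
move=> [na hs hp] hx hy hz e.
have [] := @Qi_indep a (x * (a + b) + y) (x * (a * b) - z) na.
- by apply: QiD => //; exact: QiM.
- by apply: QiB => //; exact: QiM.
- by apply/eqP; rewrite -subr_eq0 -e; apply/eqP; ring.
by move=> /eqP; rewrite addr_eq0 => /eqP-> /eqP; rewrite subr_eq0 => /eqP->.
Qed.

(* If [b] lies on the unit circle then [1 / conj b] is a root of the conjugate
   equation, so the inversion in the circle permutes the two roots. *)
Lemma conjpair_sqn1 a b : conjpair a b -> sqn b = 1 -> sqn a = 1.
Proof.
move=> cp b1; have [nb hs hp] := conjpair_sym cp.
set s := b + a in hs; set p := b * a in hp.
have bJ : b * b^*%C = 1 by rewrite mulcJE b1.
have e1 : b ^+ 2 = s * b - p by rewrite /s /p; ring.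
have e2 : b^*%C ^+ 2 = s^*%C * b^*%C - p^*%C.
  by have := congr1 conjc e1; rewrite rmorphXn rmorphB rmorphM.
(* Multiplying the conjugate equation by [b^2] and eliminating [b^2] gives a linear relation in [b];
   its constant term says [|a b| = 1]. *)
have [|||_ /eqP] := @Qi_indep b (p^*%C * s - s^*%C) (p * p^*%C - 1) nb.
- by apply: QiB; [apply: QiM|] => //; exact: Qi_conj.
- by apply: QiB; [apply: QiM => //; exact: Qi_conj|exact: Qi1].
- have e3 : 1 = s^*%C * b - p^*%C * b ^+ 2.
    transitivity ((b * b^*%C) ^+ 2); first by rewrite bJ expr1n.
    rewrite exprMn e2 mulrBr [X in X - _](_ : _ = s^*%C * b * (b * b^*%C)); last by ring.
    by rewrite bJ; ring.
  by rewrite (congr1 (fun x => p * p^*%C - x) e3) e1; ring.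
rewrite subr_eq0 mulcJE => /eqP[]; rewrite /p sqnM b1 mul1r => ->.
by [].
Qed.

Lemma quad_poly_coef c a b :
  let p := c *: (('X - a%:P) * ('X - b%:P)) in
  [/\ p`_0 = c * (a * b), p`_1 = - (c * (a + b)) & p`_2 = c].
Proof.
have E : ('X - a%:P) * ('X - b%:P) = 'X^2 - (a + b) *: 'X + (a * b)%:P :> {poly R[i]}.
  by rewrite -!mul_polyC polyCD polyCM; ring.
by rewrite /= E !coefE /=; split; ring.
Qed.

Lemma size3_root (p : {poly R[i]}) a : size p = 3%N -> root p a ->
  p`_2 * a ^+ 2 + p`_1 * a + p`_0 = 0.
Proof.
move=> s3 /rootP; rewrite horner_coef s3 !big_ord_recr big_ord0 /= => e.
by rewrite -[RHS]e; ring.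
Qed.

Lemma size3_coef2 (p : {poly R[i]}) : size p = 3%N -> p`_2 != 0.
Proof.
move=> s3; have : lead_coef p != 0 by rewrite lead_coef_eq0 -size_poly_eq0 s3.
by rewrite lead_coefE s3.
Qed.

Lemma conjpair_quadratic a b : conjpair a b ->
  quadratic_irrational a /\ conjQi a = b.
Proof.
move=> cp; have [na hs hp] := cp.
have H : quadratic_over_Qi (('X - a%:P) * ('X - b%:P)).
  have s3 : size (('X - a%:P) * ('X - b%:P)) = 3%N.
    by rewrite size_mul ?polyXsubC_eq0 // !size_XsubC.
  split=> // n; have := quad_poly_coef 1 a b; rewrite scale1r !mul1r => /= -[h0 h1 h2].
  case: n => [|[|[|n]]]; rewrite ?h0 ?h1 ?h2 //; first exact: QiN.
    exact: Qi1.
  by rewrite nth_default ?s3 //; exact: Qi0.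
split.
  split=> //; exists (('X - a%:P) * ('X - b%:P)) => //.
  by rewrite rootM root_XsubC eqxx.
rewrite /conjQi; case: xgetP => [b' _ [q [s3 Qq] qE]|]; last first.
  move=> /(_ b) []; exists (('X - a%:P) * ('X - b%:P)) => //.
  by rewrite lead_coefM !lead_coefXsubC mulr1 scale1r.
apply: conjpair_uniq cp; have q2 := size3_coef2 s3.
have := quad_poly_coef (lead_coef q) a b'; rewrite -qE => /= -[h0 h1 h2].
have lE : lead_coef q = q`_2 by rewrite lead_coefE s3.
split=> //.
  rewrite (_ : a + b' = - q`_1 / q`_2); first by apply: Qi_div => //; exact: QiN.
  by rewrite h1 lE opprK [RHS]mulrC mulKf.
rewrite (_ : a * b' = q`_0 / q`_2); first exact: Qi_div.
by rewrite h0 lE [RHS]mulrC mulKf.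
Qed.

Lemma quadratic_conjpair a : quadratic_irrational a -> conjpair a (conjQi a).
Proof.
move=> [na [p [s3 Qp] pa]]; have p2 := size3_coef2 s3.
have e := size3_root s3 pa.
have cp : conjpair a (- p`_1 / p`_2 - a).
  split=> //.
    by rewrite addrC subrK; apply: Qi_div => //; exact: QiN.
  rewrite (_ : _ * _ = p`_0 / p`_2); first exact: Qi_div.
  apply: (mulIf p2); rewrite divfK // mulrBr mulrBl.
  rewrite -mulrA divfK //; apply/eqP; rewrite -subr_eq0 -oppr_eq0; apply/eqP.
  by rewrite -[RHS]e; ring.
by have [_ ->] := conjpair_quadratic cp.
Qed.
End Conj.

(** * The domain of the natural extension *)

Section Domain.
Variable R : realType.
Implicit Types (z w a : R[i]) (M L : int) (k n j : nat).

(* [(M, L)] such that ['i ^+ n * (1 + 'i) = evenG M L] *)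
Definition dir n : int * int := nth (0, 0) [:: (1, 0); (0, -1); (-1, 0); (0, 1)] (n %% 4).
Definition dirG n : R[i] := evenG R (dir n).1 (dir n).2.
(** The scalar product of [z] and [dirG n] as plane vectors. The circle [sqn z = dirdot n z] passes
    through 0 and has centre [dirG n / 2] and radius sqrt 2 / 2. *)
Definition dirdot n z : R := (dir n).1%:~R * pc z + (dir n).2%:~R * qc z.

Lemma dir_modn n : dir (n %% 4) = dir n.
Proof. by rewrite /dir modn_mod. Qed.

Lemma dir_unit n : dir n \in units4.
Proof.
rewrite /dir; have : (n %% 4 < 4)%N by rewrite ltn_mod.
by case: (n %% 4)%N => [|[|[|[|//]]]].
Qed.

Lemma expi4 n : ('i : R[i]) ^+ n = 'i ^+ (n %% 4).
Proof.
have i4 : ('i : R[i]) ^+ 4 = 1 by rewrite (exprM 'i 2 2) sqr_i sqrrN expr1n.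
by rewrite {1}(divn_eq n 4) exprD mulnC exprM i4 expr1n mul1r.
Qed.

Lemma dirGE n : dirG n = 'i ^+ n * (1 + 'i).
Proof.
rewrite expi4 /dirG -dir_modn; have : (n %% 4 < 4)%N by rewrite ltn_mod.
have E k : 'i ^+ k * (1 + 'i) = pt k 1 0 :> R[i].
  by rewrite /pt rmorph1 rmorph0; ring.
rewrite E; case: (n %% 4)%N => [|[|[|[|//]]]] _; apply: pqP;
  rewrite ?pc_ev ?qc_ev !pqptE /dir /= ?mulrNz; ring.
Qed.

(** As [1 - 'i = 'i^3 (1 + 'i)], the one family [dirG] provides both families of centres. *)
Lemma dirGE3 n : dirG (n + 3) = 'i ^+ n * (1 - 'i).
Proof.
rewrite dirGE exprD -mulrA; congr (_ * _).
by apply: complexP; rewrite !exprS expr0 !ReImE; ring.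
Qed.

Lemma sqn_half_dir n z : sqn (z - dirG n / 2) = sqn z - dirdot n z + 1 / 2.
Proof.
rewrite !sqn_pq !pcB !qcB /dirdot.
have [-> ->] : pc (dirG n / 2) = (dir n).1%:~R /\ qc (dirG n / 2) = (dir n).2%:~R.
  have -> : (2 : R[i])^-1 = (2^-1 : R)%:C by rewrite fmorphV rmorph_nat.
  have [h1 h2] := (pc_ev R (dir n).1 (dir n).2, qc_ev R (dir n).1 (dir n).2).
  by move: h1 h2; rewrite -/(dirG n) /pc /qc !ReImE; split; lra.
by case: (dir n) (dir_unit n) => M L /units4P[] [-> ->] /=; rewrite ?mulrNz; field.
Qed.

Lemma sqrt_half_sqr : (Num.sqrt 2 / 2 : R) = Num.sqrt (1 / 2).
Proof.
rewrite -[RHS]ger0_norm ?sqrtr_ge0 // -sqrtr_sqr.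
rewrite -[LHS]ger0_norm ?divr_ge0 ?sqrtr_ge0 // -sqrtr_sqr.
by congr Num.sqrt; rewrite exprMn !sqr_sqrtr ?divr_ge0 //; field.
Qed.

Lemma lt_disc n z : ((Num.sqrt 2 / 2)%:C < `|z - dirG n / 2|) = (dirdot n z < sqn z).
Proof.
rewrite norm_sqn ltcR sqrt_half_sqr ltNge ler_sqrt ?divr_ge0 // -ltNge.
by rewrite sqn_half_dir -subr_gt0 -[RHS]subr_gt0; congr (_ < _); ring.
Qed.

Lemma disc_lt n z : (`|z - dirG n / 2| < (Num.sqrt 2 / 2)%:C) = (sqn z < dirdot n z).
Proof.
rewrite norm_sqn ltcR sqrt_half_sqr ltNge ler_sqrt ?sqn_ge0 // -ltNge.
by rewrite sqn_half_dir -subr_gt0 -[RHS]subr_gt0; congr (_ < _); ring.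
Qed.

Lemma norm_gt1 z : (1 < `|z|) = (1 < sqn z).
Proof. by rewrite -[in LHS](normr1 R[i]) norm_ltE sqn1. Qed.
Lemma norm_ge1 z : (1 <= `|z|) = (1 <= sqn z).
Proof. by rewrite -[in LHS](normr1 R[i]) norm_leE sqn1. Qed.

Lemma XaE j z : (0 < j)%N -> Xa j z <->
  squareX R z /\ forall k, (k <= 2)%N -> dirdot (k + j - 1) z < sqn z.
Proof.
move=> j0; split=> -[zX h]; split=> // k /h.
  by rewrite -dirGE lt_disc.
by rewrite -dirGE lt_disc.
Qed.

Lemma XbE j z : (0 < j)%N -> Xb j z <->
  squareX R z /\ forall k, (k <= 1)%N -> sqn z < dirdot (k + j - 1 + 3) z.
Proof.
move=> j0; split=> -[zX h]; split=> // k /h.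
  by rewrite -dirGE3 disc_lt.
by rewrite -dirGE3 disc_lt.
Qed.

Lemma WaE j w : (0 < j)%N -> Wa j w <->
  1 < sqn w /\ 1 <= sqn (w - dirG (j - 1 + 3)).
Proof. by move=> j0; rewrite /Wa /= -dirGE3 norm_gt1 norm_ge1. Qed.

Lemma WbE j w : (0 < j)%N -> Wb j w <->
  1 < sqn w /\ forall k, (k <= 1)%N -> 1 <= sqn (w - dirG (k + j - 1 + 3)).
Proof.
move=> j0; split=> -[w1 h]; split; rewrite ?norm_gt1 // -?norm_gt1 // => k /h.
  by rewrite -dirGE3 norm_ge1.
by rewrite -dirGE3 norm_ge1.
Qed.

Lemma XtildeE z w : Xtilde R (z, Some w) <->
  exists2 j, (1 <= j <= 4)%N & (closure (@Xa R j) z /\ Wa j w) \/ (Xb j z /\ Wb j w).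
Proof.
have E (W : set (Cplx R)) : addoo W (Some w) <-> W w.
  by split=> [[[w' Ww' [<-]]|//]|Ww] //; left; exists w.
split.
  by move=> [] [j /= hj [/= h1 /E h2]]; exists j => //; [left|right].
by move=> [j hj [[h1 h2]|[h1 h2]]]; [left|right]; exists j => //; split => //; apply/E.
Qed.

Lemma Qi_pq z (s t : rat) : pc z = ratr s -> qc z = ratr t -> Qi z.
Proof.
rewrite /pc /qc => h1 h2; apply/QiP; exists ((s + t) / 2), ((s - t) / 2).
by rewrite !fmorph_div rmorphD rmorphB /= -h1 -h2 rmorph_nat; split; field.
Qed.

Lemma closure_halfplane (A : set (Cplx R)) (a : Cplx R) n :
  inX a -> closure A a -> (forall z, A z -> dirdot n z < sqn z) ->
  dirdot n a <= sqn a.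
Proof.
move=> [] + + /closure_pqP cA AN; rewrite !ler_norml => hp hq.
rewrite leNgt; apply/negP => lt; set d := dirdot n a - sqn a.
have d0 : 0 < d by rewrite /d subr_gt0.
(* Moving the coordinates by less than [e <= 1] raises [sqn] by at most [3 e] and lowers [dirdot n]
   by less than [e], in total less than [d]. *)
pose e := Num.min 1 (d / 5); have e0 : 0 < e by rewrite lt_min; lra.
have e1 : e <= 1 by rewrite ge_min lexx.
have e5 : 5 * e <= d.
  have : e <= d / 5 by rewrite ge_min lexx orbT.
  lra.
have [w /AN + [wp wq]] := cA e e0.
move: e5; rewrite /d /dirdot !sqn_pq.
move: wp wq; set x := pc w; set y := qc w; set p := pc a in hp *; set q := qc a in hq *.
rewrite !ltr_norml => wp wq.
have h1 : p ^+ 2 - x ^+ 2 >= - (3 * e).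
  rewrite (_ : _ - _ = (x - p) * (x - p) - 2 * (x - p) * x); last by ring.
  nra.
have h2 : q ^+ 2 - y ^+ 2 >= - (3 * e) by nra.
by case: (dir n) (dir_unit n) => M L /units4P[] [-> ->] /=; rewrite ?mulrNz; lra.
Qed.
End Domain.

(** * Points outside the discs and the closure of [Xa] *)

Section Domain2.
Variable R : realType.
Implicit Types (z w a : R[i]) (M L : int) (k n j : nat).

(** Shrinking [x] lowers [2 x - x^2] by at least [2 t x (1 - x)], and shrinking [y] lowers [y^2] by
    at most [2 s]. The choice [2 s = t x (1 - x)] spends half of the gain. If [x = 0], positivity of
    [y] is enough. *)
Lemma lens_approx (x y e : R) : 0 <= x < 1 -> 0 < y <= 1 ->
  2 * x <= x ^+ 2 + y ^+ 2 -> 0 < e ->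
  exists t s : R, [/\ 0 < t < 1, 0 < s < 1, t < e, s < e &
    2 * ((1 - t) * x) < ((1 - t) * x) ^+ 2 + ((1 - s) * y) ^+ 2].
Proof.
move=> /andP[x0 x1] /andP[y0 y1] xy e0.
pose t := Num.min 1 e / 2.
have [t0 t1 te] : [/\ 0 < t, t < 1 & t < e].
  have h0 : 0 < Num.min 1 e by rewrite lt_min ltr01.
  have h1 : Num.min 1 e <= 1 by rewrite ge_min lexx.
  have h2 : Num.min 1 e <= e by rewrite ge_min lexx orbT.
  by rewrite /t; split; lra.
have [x00|xn0] := eqVneq x 0.
  exists t, t; split; rewrite ?t0 ?t1 // x00 !mulr0 expr0n /= add0r.
  by rewrite exprn_gt0 // mulr_gt0 // subr_gt0.
have {}x0 : 0 < x by rewrite lt_def xn0.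
have u0 : 0 < x * (1 - x) by rewrite mulr_gt0 // subr_gt0.
have u1 : x * (1 - x) <= 1 by nra.
exists t, (t * (x * (1 - x)) / 2).
have s0 : 0 < t * (x * (1 - x)) by rewrite mulr_gt0.
have st : t * (x * (1 - x)) <= t by rewrite ger_pMr.
split; rewrite ?t0 ?t1 //; try lra.
set s := t * (x * (1 - x)) / 2.
have y2 : y ^+ 2 <= 1 by rewrite expr_le1 // ltW.
have hs : y ^+ 2 - 2 * s <= ((1 - s) * y) ^+ 2.
  have e1 : ((1 - s) * y) ^+ 2 = y ^+ 2 - 2 * s * y ^+ 2 + (s * y) ^+ 2 by ring.
  have h1 : s * y ^+ 2 <= s by rewrite ger_pMr // /s; lra.
  by rewrite e1; have := sqr_ge0 (s * y); lra.
have ht : 2 * ((1 - t) * x) - ((1 - t) * x) ^+ 2 =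
    2 * x - x ^+ 2 - 2 * t * (x * (1 - x)) - (t * x) ^+ 2 by ring.
have := sqr_ge0 (t * x); have := hs; rewrite /s; lra.
Qed.

Lemma Qi_corner a : `|pc a| ^+ 2 = `|pc a| -> `|qc a| ^+ 2 = `|qc a| -> Qi a.
Proof.
have H (x : R) : `|x| ^+ 2 = `|x| -> exists s : rat, x = ratr s.
  move=> /eqP; rewrite expr2 -subr_eq0 -[X in _ - X]mulr1 -mulrBr mulf_eq0 subr_eq0.
  move=> /orP[/eqP/normr0_eq0->|]; first by exists 0; rewrite rmorph0.
  rewrite eqr_norml => /andP[/orP[] /eqP-> _]; first by exists 1; rewrite rmorph1.
  by exists (-1); rewrite rmorphN rmorph1.
by move=> /H[s ps] /H[t qt]; exact: Qi_pq ps qt.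
Qed.

(** The four discs cover the closed square up to 0 and the vertices: the sum of the inequalities is
    [|p| + |q| <= p^2 + q^2], which forces [|p|] and [|q|] to be 0 or 1. *)
Lemma inX_outside_Qi a : inX a -> `|pc a| <= sqn a -> `|qc a| <= sqn a -> Qi a.
Proof.
move=> [p1 q1]; rewrite sqn_pq -(real_normK (num_real (pc a))).
rewrite -(real_normK (num_real (qc a))) => hp hq.
have p0 := normr_ge0 (pc a); have q0 := normr_ge0 (qc a).
have hp2 : 0 <= `|pc a| * (1 - `|pc a|) by rewrite mulr_ge0 ?subr_ge0.
have hq2 : 0 <= `|qc a| * (1 - `|qc a|) by rewrite mulr_ge0 ?subr_ge0.
by apply: Qi_corner; lra.
Qed.

(** If [|pc a| = 1], then [1 <= (1 + q^2) / 2] for [q = qc a] makes [a] a vertex, hence rational;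
    likewise for [qc a]. *)
Lemma inX_norm_lt1 a : inX a -> ~ Qi a ->
  (`|pc a| <= sqn a -> `|pc a| < 1) /\ (`|qc a| <= sqn a -> `|qc a| < 1).
Proof.
move=> [p1 q1] na; rewrite sqn_pq -(real_normK (num_real (pc a))).
rewrite -(real_normK (num_real (qc a))).
have p0 := normr_ge0 (pc a); have q0 := normr_ge0 (qc a).
split=> h; rewrite lt_neqAle ?p1 ?q1 andbT; apply/eqP => e; apply: na.
  apply: Qi_corner; rewrite ?e ?expr1n //.
  rewrite e expr1n in h; suff -> : `|qc a| = 1 by rewrite expr1n.
  nra.
apply: Qi_corner; rewrite ?e ?expr1n //.
rewrite e expr1n in h; suff -> : `|pc a| = 1 by rewrite expr1n.
nra.
Qed.

Lemma dirdotE z : [/\ dirdot 0 z = pc z, dirdot 1 z = - qc z,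
  dirdot 2 z = - pc z & dirdot 3 z = qc z].
Proof. by rewrite /dirdot /dir /= ?mulrNz; split; ring. Qed.

Lemma dirdotS4 n z : dirdot (n + 4) z = dirdot n z.
Proof. by rewrite /dirdot -(dir_modn (n + 4)) modnDr dir_modn. Qed.

Lemma closure_Xa (a : Cplx R) j : (1 <= j <= 4)%N -> inX a -> ~ Qi a ->
  (forall k, (k <= 2)%N -> dirdot (k + j - 1) a <= sqn a) -> closure (@Xa R j) a.
Proof.
move=> hj aX na h; have /andP[j0 _] := hj.
have [lp lq] := inX_norm_lt1 aX na.
have no := fun hp hq => na (inX_outside_Qi aX hp hq).
have [p1 q1] := aX.
apply/closure_pqP => e e0.
have [d0 d1 d2 d3] := dirdotE a.
have d4 : dirdot 4 a = pc a by rewrite (dirdotS4 0).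
have d5 : dirdot 5 a = - qc a by rewrite (dirdotS4 1).
(* The four values of [j] differ by a rotation. In rotated coordinates the three avoided discs give
   [|P|, - Q <= sqn a]; then [Q > 0], as otherwise all four discs are avoided, and [lens_approx]
   moves the point into the open region. *)
have key (P Q : R) : `|P| <= 1 -> `|Q| <= 1 -> sqn a = (P ^+ 2 + Q ^+ 2) / 2 ->
    P <= sqn a -> - P <= sqn a -> - Q <= sqn a ->
    (`|P| <= sqn a -> `|P| < 1) -> (`|P| <= sqn a -> `|Q| <= sqn a -> False) ->
    exists P' Q' : R, [/\ -1 < P' < 1, -1 < Q' < 1, `|P' - P| < e, `|Q' - Q| < e &
      [/\ P' < (P' ^+ 2 + Q' ^+ 2) / 2, - P' < (P' ^+ 2 + Q' ^+ 2) / 2 &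
      - Q' < (P' ^+ 2 + Q' ^+ 2) / 2]].
  move=> P1 Q1 N hP hP' hQ lP noPQ.
  have PN : `|P| <= sqn a by rewrite ler_norml; lra.
  have Q0 : 0 < Q.
    rewrite ltNge; apply/negP => Q0; apply: noPQ => //.
    by rewrite ler0_norm.
  have [|||t [s [/andP[t0 t1] /andP[s0 s1] te se lt]]] :=
      @lens_approx `|P| Q e _ _ _ e0.
  - by rewrite normr_ge0 lP.
  - by rewrite Q0 -[Q]gtr0_norm.
  - by rewrite real_normK ?num_real //; rewrite N in PN; lra.
  have PP : `|(1 - t) * P| = (1 - t) * `|P| by rewrite normrM gtr0_norm ?subr_gt0.
  have Q1' : Q <= 1 by rewrite -[Q]gtr0_norm.
  have Q'0 : 0 < (1 - s) * Q by rewrite mulr_gt0 ?subr_gt0.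
  have : `|(1 - t) * P| < ((((1 - t) * P) ^+ 2 + ((1 - s) * Q) ^+ 2)) / 2.
    by rewrite -(real_normK (num_real ((1 - t) * P))) PP; lra.
  rewrite ltr_norml => /andP[c1 c2].
  exists ((1 - t) * P), ((1 - s) * Q); split.
  - by rewrite -ltr_norml PP mulr_ilt1 ?subr_ge0 ?lP // ?ltW //; lra.
  - have : s * Q > 0 by rewrite mulr_gt0.
    by move=> sQ; apply/andP; split; lra.
  - rewrite (_ : _ - P = - (t * P)); last by ring.
    rewrite normrN normrM gtr0_norm //; apply: le_lt_trans te.
    by rewrite ger_pMr.
  - rewrite (_ : _ - Q = - (s * Q)); last by ring.
    rewrite normrN normrM gtr0_norm //; apply: le_lt_trans se.
    by rewrite ger_pMr.
  by split; lra.
have N := sqn_pq a.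
have Xw (P' Q' : R) : dirdot (j - 1) (ofpq P' Q') < sqn (ofpq P' Q') ->
    dirdot j (ofpq P' Q') < sqn (ofpq P' Q') ->
    dirdot j.+1 (ofpq P' Q') < sqn (ofpq P' Q') ->
    -1 < P' < 1 -> -1 < Q' < 1 -> `|P' - pc a| < e -> `|Q' - qc a| < e ->
    exists2 w : Cplx R, Xa j w & `|pc w - pc a| < e /\ `|qc w - qc a| < e.
  move=> k0 k1 k2 h1 h2 h3 h4; exists (ofpq P' Q'); rewrite ?pc_ofpq ?qc_ofpq //.
  apply/XaE => //.
  split; first by apply/squareXE; rewrite pc_ofpq qc_ofpq; lra.
  move=> [|[|[|//]]] _; rewrite ?add0n // ?add1n ?subSS ?subn0 //.
have [[h0 h1] h2] := (h 0%N isT, h 1%N isT, h 2%N isT).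
have E P' Q' := sqn_pq (ofpq P' Q' : R[i]).
have W4 P' Q' : dirdot 4 (ofpq P' Q' : R[i]) = P'.
  by rewrite (dirdotS4 0); have [-> _ _ _] := dirdotE (ofpq P' Q'); rewrite pc_ofpq.
have W5 P' Q' : dirdot 5 (ofpq P' Q' : R[i]) = - Q'.
  by rewrite (dirdotS4 1); have [_ -> _ _] := dirdotE (ofpq P' Q'); rewrite qc_ofpq.
have WE P' Q' := dirdotE (ofpq P' Q' : R[i]).
move: Xw h0 h1 h2 {h j0}; case: j hj => [//|[|[|[|[|//]]]]] _ Xw.
- rewrite -[(0 + 1 - 1)%N]/0%N -[(1 + 1 - 1)%N]/1%N -[(2 + 1 - 1)%N]/2%N d0 d1 d2 => h0 h1 h2.
  have [P' [Q' [r1 r2 r3 r4 [r5 r6 r7]]]] := key _ _ p1 q1 N h0 h2 h1 lp no.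
  have [w0 w1 w2 w3] := WE P' Q'.
  by apply: (Xw P' Q') => //; rewrite ?w0 ?w1 ?w2 ?w3 ?W4 ?W5 E ?pc_ofpq ?qc_ofpq.
- rewrite -[(0 + 2 - 1)%N]/1%N -[(1 + 2 - 1)%N]/2%N -[(2 + 2 - 1)%N]/3%N d1 d2 d3 => h0 h1 h2.
  have N' : sqn a = (qc a ^+ 2 + pc a ^+ 2) / 2 by rewrite addrC.
  have [P' [Q' [r1 r2 r3 r4 [r5 r6 r7]]]] := key _ _ q1 p1 N' h2 h0 h1 lq (fun x y => no y x).
  have [w0 w1 w2 w3] := WE Q' P'.
  apply: (Xw Q' P') => //; rewrite ?w0 ?w1 ?w2 ?w3 ?W4 ?W5 E ?pc_ofpq ?qc_ofpq;
    by rewrite [X in X / 2]addrC.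
- rewrite -[(0 + 3 - 1)%N]/2%N -[(1 + 3 - 1)%N]/3%N -[(2 + 3 - 1)%N]/4%N d2 d3 d4 => h0 h1 h2.
  have N' : sqn a = (pc a ^+ 2 + (- qc a) ^+ 2) / 2 by rewrite sqrrN.
  have q1' : `|- qc a| <= 1 by rewrite normrN.
  have h1' : - - qc a <= sqn a by rewrite opprK.
  have no' : `|pc a| <= sqn a -> `|- qc a| <= sqn a -> False by rewrite normrN.
  have [P' [Q' [r1 r2 r3 r4 [r5 r6 r7]]]] := key _ _ p1 q1' N' h2 h0 h1' lp no'.
  have [w0 w1 w2 w3] := WE P' (- Q').
  apply: (Xw P' (- Q')) => //; rewrite ?w0 ?w1 ?w2 ?w3 ?W4 ?W5 ?E ?pc_ofpq ?qc_ofpq ?sqrrN //.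
  + by lra.
  + by rewrite -normrN opprD !opprK; rewrite opprK in r4.
rewrite -[(0 + 4 - 1)%N]/3%N -[(1 + 4 - 1)%N]/4%N -[(2 + 4 - 1)%N]/5%N d3 d4 d5 => h0 h1 h2.
have N' : sqn a = (qc a ^+ 2 + (- pc a) ^+ 2) / 2 by rewrite sqrrN addrC.
have p1' : `|- pc a| <= 1 by rewrite normrN.
have h1' : - - pc a <= sqn a by rewrite opprK.
have no' : `|qc a| <= sqn a -> `|- pc a| <= sqn a -> False.
  by rewrite normrN => x y; exact: no.
have [P' [Q' [r1 r2 r3 r4 [r5 r6 r7]]]] := key _ _ q1 p1' N' h0 h2 h1' lq no'.
have [w0 w1 w2 w3] := WE (- Q') P'.
apply: (Xw (- Q') P') => //; rewrite ?w0 ?w1 ?w2 ?w3 ?W4 ?W5 ?E ?pc_ofpq ?qc_ofpq ?sqrrN //.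
- by rewrite [X in X / 2]addrC.
- by rewrite [X in X / 2]addrC.
- by rewrite [X in X / 2]addrC.
- by lra.
by rewrite -normrN opprD !opprK; rewrite opprK in r4.
Qed.

Lemma units4_dir M L : (M, L) \in units4 -> exists2 n, (n < 4)%N & (M, L) = dir n.
Proof.
by case/units4P => -[-> ->]; [exists 0%N|exists 2%N|exists 3%N|exists 1%N].
Qed.

Lemma reduced_dirP z w : reduced z w 1 <-> 1 <= sqn w /\
  forall n, (n < 4)%N -> sqn z < dirdot n z -> 1 <= sqn (w - dirG R n).
Proof.
rewrite /reduced sqn1; split=> -[w1 h]; split=> //.
  by move=> n _; have := h _ _ (dir_unit n); rewrite mulr1.
move=> M L /units4_dir[n n4 e]; rewrite mulr1 => lt.
by have := h n n4; rewrite /dirG /dirdot -e; apply.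
Qed.

(** [dirG (n + 2) = - dirG n], and open discs with opposite centres are disjoint. *)
Lemma dirdot_lt_absurd n z : sqn z < dirdot n z -> sqn z < dirdot (n + 2) z -> False.
Proof.
have E : dirdot (n + 2) z = - dirdot n z.
  rewrite /dirdot /dir -(modnDml n).
  have : (n %% 4 < 4)%N by rewrite ltn_mod.
  by case: (n %% 4)%N => [|[|[|[|//]]]] _ /=; rewrite ?mulrNz; ring.
by rewrite E; have := sqn_ge0 z; lra.
Qed.

End Domain2.

(** * Reduced pairs and the points of [Xtilde] *)

Section Domain3.
Variable R : realType.
Implicit Types (z w a : R[i]) (k n j : nat).

Lemma dir_congr n k z : n = k %[mod 4] ->
  dirdot n z = dirdot k z /\ dirG R n = dirG R k.
Proof. by move=> e; rewrite /dirdot /dirG -(dir_modn n) e dir_modn. Qed.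

(** A point of the closure of [Xa j] avoids all discs but that of index [j - 1 + 3], the one
    constrained in [Wa j]. A point of [Xb j] is in two neighbouring discs, which excludes their
    opposites, and [Wb j] constrains exactly those two. *)
Lemma Xtilde_reduced (a w : Cplx R) : inX a -> Xtilde R (a, Some w) -> reduced a w 1.
Proof.
move=> aX /XtildeE[j /andP[j1 j4]] [[cX /(WaE _ j1)[w1 w2]]|[/(XbE _ j1)[_ h] /(WbE _ j1)[w1 w2]]].
  have h k : (k <= 2)%N -> dirdot (k + j - 1) a <= sqn a.
    by move=> k2; apply: closure_halfplane aX cX _ => z /(XaE _ j1)[_]; apply.
  apply/reduced_dirP; split; first exact: ltW.
  move=> n n4 lt; pose k := ((n + 4 - (j - 1)) %% 4)%N.
  have kn : (k + j - 1 = n %[mod 4])%N by rewrite /k; lia.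
  have [k2|k3] := leqP k 2.
    by have := h k k2; have [-> _] := dir_congr a kn; rewrite leNgt lt.
  have kn' : (n = j - 1 + 3 %[mod 4])%N by move: k3 kn; rewrite /k; lia.
  by have [_ ->] := dir_congr a kn'.
apply/reduced_dirP; split; first exact: ltW.
move=> n n4 lt.
have main k : (k <= 1)%N -> (n = k + j - 1 + 3 %[mod 4])%N -> 1 <= sqn (w - dirG R n).
  by move=> k1 kn; have [_ ->] := dir_congr a kn; exact: w2.
have opp k : (k <= 1)%N -> (n + 2 = k + j - 1 + 3 %[mod 4])%N -> False.
  move=> k1 kn; apply: (dirdot_lt_absurd lt).
  by have [-> _] := dir_congr a kn; exact: h.
have [/(main 0%N isT)|] := eqVneq (n %% 4)%N ((0 + j - 1 + 3) %% 4)%N; first exact.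
have [/(main 1%N isT)|] := eqVneq (n %% 4)%N ((1 + j - 1 + 3) %% 4)%N; first exact.
have [/(opp 0%N isT)|] := eqVneq ((n + 2) %% 4)%N ((0 + j - 1 + 3) %% 4)%N; first by case.
have [/(opp 1%N isT)|] := eqVneq ((n + 2) %% 4)%N ((1 + j - 1 + 3) %% 4)%N; first by case.
by clear -j1 j4 n4; lia.
Qed.

(** An irrational point is in at least one disc. Opposite discs being disjoint, it is either in two
    neighbouring ones, which gives [Xb], or in a single one, which gives the closure of [Xa]. *)
Lemma reduced_Xtilde (a w : Cplx R) : inX a -> ~ Qi a -> reduced a w 1 -> 1 < sqn w ->
  Xtilde R (a, Some w).
Proof.
move=> aX na /reduced_dirP[_ inv] w1; apply/XtildeE.
have inv' n : sqn a < dirdot n a -> 1 <= sqn (w - dirG R n).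
  have [<- <-] := dir_congr a (modn_mod n 4); apply: inv; exact: ltn_pmod.
have [n Sn] : exists n, sqn a < dirdot n a.
  apply/not_existsP => no; apply: na; apply: inX_outside_Qi => //.
    have [d0 _ d2 _] := dirdotE a; have := no 0%N; have := no 2%N.
    rewrite d0 d2 ler_norml => /negP; rewrite -leNgt => h1 /negP; rewrite -leNgt => h2.
    lra.
  have [_ d1 _ d3] := dirdotE a; have := no 1%N; have := no 3%N.
  rewrite d1 d3 ler_norml => /negP; rewrite -leNgt => h1 /negP; rewrite -leNgt => h2.
  lra.
(* Two neighbouring discs meet inside the open square: [x^2 + y^2 < 2 x] and [x^2 + y^2 < 2 y] force
   [x, y < 1]. *)
have two k : sqn a < dirdot k a -> sqn a < dirdot k.+1 a -> squareX R a.
  move=> h1 h2; apply/squareXE.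
  have [d0 d1 d2 d3] := dirdotE a.
  have d4 : dirdot 4 a = pc a by rewrite (dirdotS4 0).
  have [hp hq] : sqn a < `|pc a| /\ sqn a < `|qc a|.
    rewrite !ltr_normr; move: h1 h2.
    have k4 : (k %% 4 < 4)%N by rewrite ltn_mod.
    have [-> _] := dir_congr a (esym (modn_mod k 4)).
    have -> : dirdot k.+1 a = dirdot (k %% 4).+1 a.
      by apply: (proj1 (dir_congr a _)); rewrite -[in RHS]addn1 modnDml addn1.
    case: (k %% 4)%N k4 => [|[|[|[|//]]]] _; rewrite ?d0 ?d1 ?d2 ?d3 ?d4 => -> ->;
      by rewrite ?orbT.
  move: aX => [] ; rewrite !ler_norml => p1 q1.
  move: hp hq; rewrite sqn_pq -(real_normK (num_real (pc a))) -(real_normK (num_real (qc a))).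
  set x := `|pc a|; set y := `|qc a| => hp hq.
  suff : x < 1 /\ y < 1 by rewrite /x /y !ltr_norml; lra.
  by have := sqr_ge0 (1 - x); have := sqr_ge0 (1 - y); split; nra.
have Xb2 k : sqn a < dirdot k a -> sqn a < dirdot k.+1 a ->
    exists2 j, (1 <= j <= 4)%N & (closure (@Xa R j) a /\ Wa j w) \/ (Xb j a /\ Wb j w).
  (* This is the [j] between 1 and 4 with [j - 1 + 3 = k] modulo 4. *)
  move=> h1 h2; exists ((k + 1) %% 4).+1; first by clear; lia.
  have E i : (i + ((k + 1) %% 4).+1 - 1 + 3 = k + i %[mod 4])%N by clear; lia.
  right; split.
    apply/XbE => //; split; first exact: two h1 h2.
    move=> i i1; have [-> _] := dir_congr a (E i).
    by case: i i1 => [|[|//]] _; rewrite ?addn0 ?addn1.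
  apply/WbE => //; split => //.
  move=> i i1; apply: inv'; have [-> _] := dir_congr a (E i).
  by case: i i1 => [|[|//]] _; rewrite ?addn0 ?addn1.
have [S1|S1] := boolP (sqn a < dirdot n.+1 a); first exact: (Xb2 n).
have [S3|S3] := boolP (sqn a < dirdot (n + 3) a).
  apply: (Xb2 (n + 3)%N) => //.
  by rewrite -addnS dirdotS4.
have S2 : ~~ (sqn a < dirdot (n + 2) a) by apply/negP => /(dirdot_lt_absurd Sn).
exists ((n + 1) %% 4).+1; first by clear; lia.
left; split.
  apply: closure_Xa => //; first by clear; lia.
  have E i : (i + ((n + 1) %% 4).+1 - 1 = n + i.+1 %[mod 4])%N by clear; lia.
  move=> i i2; have [-> _] := dir_congr a (E i); rewrite leNgt.
  by case: i i2 => [|[|[|//]]] _; rewrite ?addn1.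
apply/WaE => //; split=> //; apply: inv'.
have E : (((n + 1) %% 4).+1 - 1 + 3 = n %[mod 4])%N by clear; lia.
by have [-> _] := dir_congr a E.
Qed.
End Domain3.

(** * Orbits *)

Section Orbit.
Variable R : realType.
Local Notation Re := (@complex.Re R).
Local Notation Im := (@complex.Im R).
Implicit Types (z w a b p q : R[i]) (m l M L : int) (k n : nat).

Lemma gaussP z : gauss_int z <-> exists m n : int, Re z = m%:~R /\ Im z = n%:~R.
Proof.
split=> -[m [n]]; first by move=> ->; exists m, n; rewrite !ReImE; split; ring.
by move=> [h1 h2]; exists m, n; apply: complexP; rewrite !ReImE ?h1 ?h2; ring.
Qed.

Lemma gaussD z w : gauss_int z -> gauss_int w -> gauss_int (z + w).
Proof.
move=> /gaussP[s [t [h1 h2]]] /gaussP[s' [t' [h3 h4]]]; apply/gaussP.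
by exists (s + s'), (t + t'); rewrite !ReImE !rmorphD /= h1 h2 h3 h4.
Qed.
Lemma gaussN z : gauss_int z -> gauss_int (- z).
Proof.
move=> /gaussP[s [t [h1 h2]]]; apply/gaussP.
by exists (- s), (- t); rewrite !ReImE !rmorphN /= h1 h2.
Qed.
Lemma gaussB z w : gauss_int z -> gauss_int w -> gauss_int (z - w).
Proof. by move=> hz hw; exact: gaussD hz (gaussN hw). Qed.
Lemma gaussM z w : gauss_int z -> gauss_int w -> gauss_int (z * w).
Proof.
move=> /gaussP[s [t [h1 h2]]] /gaussP[s' [t' [h3 h4]]]; apply/gaussP.
exists (s * s' - t * t'), (s * t' + t * s').
by rewrite !ReImE rmorphB rmorphD !rmorphM /= h1 h2 h3 h4.
Qed.
Lemma gauss_ev m l : gauss_int (evenG R m l).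
Proof. by apply/gaussP; exists (m + l), (m - l). Qed.
Lemma gauss_nat n : gauss_int (n%:R : R[i]).
Proof. by apply/gaussP; exists n%:Z, 0; rewrite !ReImE. Qed.
Lemma gauss0 : gauss_int (0 : R[i]). Proof. exact: (gauss_nat 0). Qed.
Lemma gauss1 : gauss_int (1 : R[i]). Proof. exact: (gauss_nat 1). Qed.

Lemma gauss_sqn z : gauss_int z -> exists n, sqn z = n%:R.
Proof.
move=> /gaussP[m [n [h1 h2]]]; exists (`|m| ^ 2 + `|n| ^ 2)%N.
rewrite /sqn h1 h2 natrD !natrX !natr_absz.
by rewrite !intr_norm !real_normK ?num_real.
Qed.

Lemma gauss_sqn_lt1 z : gauss_int z -> sqn z < 1 -> z = 0.
Proof.
move=> /gauss_sqn[[|n] e]; rewrite e ?ltrn1 // => _.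
by apply/eqP; rewrite -sqn_eq0 e.
Qed.

Lemma TH_digit z : z != 0 -> ~ gauss_int z^-1 ->
  exists m l, TH z = z^-1 - evenG R m l /\ digit z^-1 m l.
Proof.
move=> z0 /floorHP[m [l [fE d]]]; exists m, l; split=> //.
by rewrite /TH (negbTE z0) fE.
Qed.

Lemma TH_gauss z : gauss_int z^-1 -> TH z = 0.
Proof.
by move=> /asboolP g; rewrite /TH; case: eqP => // _; rewrite /floorH g subrr.
Qed.

Lemma hurwitz_seqS a k : hurwitz_seq a k.+1 =
  if a == 0 then None else hurwitz_seq (TH a) k.
Proof.
elim: k => [|k IH] //.
rewrite [LHS](_ : _ = if hurwitz_seq a k.+1 is Some z then
  if z == 0 then None else Some (TH z) else None) // IH.
by case: eqP.
Qed.

Lemma inX_sqn_lt1 a : inX a -> ~ Qi a -> sqn a < 1.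
Proof.
move=> aX na; rewrite lt_neqAle inX_sqn // andbT; apply/eqP => a1.
by apply: na; apply: inX_outside_Qi; rewrite ?a1; case: aX.
Qed.

Lemma inX_sqn1 z : inX z -> sqn z = 1 -> gauss_int z^-1.
Proof.
move=> [] + + z1; rewrite !ler_norml => /andP[p1 p2] /andP[q1 q2].
have z0 : z != 0 by rewrite -sqn_gt0 z1.
have e : pc z ^+ 2 + qc z ^+ 2 = 2.
  by move: z1; rewrite sqn_pq => h; lra.
have hp : pc z = 1 \/ pc z = -1.
  have : (pc z - 1) * (pc z + 1) = 0 by nra.
  by move=> /eqP; rewrite mulf_eq0 subr_eq0 addr_eq0 => /orP[] /eqP ->; tauto.
have hq : qc z = 1 \/ qc z = -1.
  have : (qc z - 1) * (qc z + 1) = 0 by nra.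
  by move=> /eqP; rewrite mulf_eq0 subr_eq0 addr_eq0 => /orP[] /eqP ->; tauto.
apply/gaussP; have [-> ->] := ReImV z0; rewrite z1 !divr1.
move: hp hq; rewrite /pc /qc => -[hp|hp] [hq|hq].
- by exists 1, 0; lra.
- by exists 0, (-1); rewrite mulrNz; lra.
- by exists 0, 1; lra.
by exists (-1), 0; rewrite mulrNz; lra.
Qed.

(** Euclid's algorithm in Z[i]: [p / q] is followed by [(q - e p) / p], and [|p| < |q|] unless
    [p / q] is a vertex, whose inverse is a Gaussian integer. *)
Lemma gauss_quotient_terminates p q : gauss_int p -> gauss_int q -> q != 0 ->
  inX (p / q) -> exists n, hurwitz_seq (p / q) n = None.
Proof.
move=> gp gq; have [k] := gauss_sqn gq.
elim/ltn_ind: k p q gp gq => k IH p q gp gq qk q0 zX.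
have [z0|z0] := eqVneq (p / q) 0; first by exists 1%N; rewrite /= z0 eqxx.
have [gz|ngz] := pselect (gauss_int (p / q)^-1).
  by exists 2%N; rewrite !hurwitz_seqS (negbTE z0) TH_gauss // eqxx.
have p0 : p != 0 by apply: contraNneq z0 => ->; rewrite mul0r.
have [m [l [TE d]]] := TH_digit z0 ngz.
have [i pi] := gauss_sqn gp.
have ik : (i < k)%N.
  rewrite -(ltr_nat R) -pi -qk -[ltRHS]mul1r -ltr_pdivrMr ?sqn_gt0 //.
  rewrite -sqnV -sqnM lt_neqAle inX_sqn // andbT.
  by apply/eqP => /(inX_sqn1 zX).
have E : TH (p / q) = (q - evenG R m l * p) / p.
  by rewrite TE invf_div mulrBl mulfK.
have := digit_inX d; rewrite -TE E => X'.
have [|n hn] := IH i ik (q - evenG R m l * p) p _ gp pi p0 X'.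
  by apply: gaussB => //; apply: gaussM => //; exact: gauss_ev.
by exists n.+1; rewrite hurwitz_seqS (negbTE z0) E.
Qed.

Lemma Qi_fraction z : Qi z -> exists p q, [/\ gauss_int p, gauss_int q, q != 0 & z = p / q].
Proof.
move=> /QiP[s [t [h1 h2]]].
have dE (r : rat) : (ratr r : R) * (denq r)%:~R = (numq r)%:~R.
  by rewrite {1}/ratr divfK // intr_eq0 denq_neq0.
pose d := denq s * denq t.
have q0 : (d%:~R : R[i]) != 0 by rewrite intr_eq0 mulf_neq0 ?denq_neq0.
exists (z * d%:~R), d%:~R; split=> //; last by rewrite mulfK.
  apply/gaussP; exists (numq s * denq t), (numq t * denq s).
  by rewrite !ReImE h1 h2 !rmorphM /= -!dE; split; ring.
by apply/gaussP; exists d, 0; rewrite !ReImE.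
Qed.

Lemma nonterminating_irrational a : inX a -> (forall n, hurwitz_seq a n <> None) -> ~ Qi a.
Proof.
move=> aX no /Qi_fraction[p [q [gp gq q0 aE]]].
have [|n hn] := gauss_quotient_terminates gp gq q0; first by rewrite -aE.
by apply: (no n); rewrite aE.
Qed.

Lemma TH_irr a : ~ Qi a ->
  exists m l, [/\ TH a = a^-1 - evenG R m l, digit a^-1 m l, inX (TH a) & ~ Qi (TH a)].
Proof.
move=> na; have a0 := Qi_neq0 na.
have na' : ~ Qi a^-1 by move=> /QiV; rewrite invrK.
have [|m [l [TE d]]] := TH_digit a0; first by move=> /gauss_Qi.
exists m, l; split=> //; rewrite TE; first exact: digit_inX.
by move=> h; apply: na'; rewrite -(subrK (evenG R m l) a^-1); apply: QiD => //; exact: Qi_ev.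
Qed.

Lemma iter_TH_irr a n : inX a -> ~ Qi a -> inX (iter n (@TH R) a) /\ ~ Qi (iter n (@TH R) a).
Proof.
by move=> aX na; elim: n => [//|n [_ /TH_irr[m [l [_ _ h1 h2]]]]]; split.
Qed.

Lemma hurwitz_seq_irr a n : inX a -> ~ Qi a ->
  hurwitz_seq a n = Some (iter n (@TH R) a).
Proof.
move=> aX na; elim: n => [//|n IH] /=; rewrite IH.
by have [_ /Qi_neq0/negbTE->] := iter_TH_irr n aX na.
Qed.

(** The working form of [(a, a')] being in [Xtilde]. It asks only for [|b| >= 1]; [reduced_sqn_gt1]
    recovers the strict inequality. *)
Definition conj_reduced a := exists b, [/\ inX a, conjpair a b & reduced a b 1].

Lemma reduced_sqn_gt1 a b : inX a -> conjpair a b -> reduced a b 1 -> 1 < sqn b.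
Proof.
move=> aX cp [b1 _]; rewrite sqn1 in b1; rewrite lt_neqAle b1 andbT eq_sym.
apply/eqP => /(conjpair_sqn1 cp) a1; have [na _ _] := cp.
by have := inX_sqn_lt1 aX na; rewrite a1 ltxx.
Qed.

Lemma reducedZ z A C t : t != 0 -> reduced z (t * A) (t * C) <-> reduced z A C.
Proof.
move=> t0; have t1 : 0 < sqn t by rewrite sqn_gt0.
have E x : t * A - x * (t * C) = t * (A - x * C) by ring.
rewrite /reduced !sqnM ler_pM2l //; split=> -[h1 h2]; split=> // M L u lt.
  by have := h2 M L u lt; rewrite E !sqnM ler_pM2l.
by rewrite E !sqnM ler_pM2l //; exact: h2.
Qed.

Lemma conj_reduced_step a b : inX a -> conjpair a b -> reduced a b 1 ->
  exists m l, [/\ TH a = a^-1 - evenG R m l, digit a^-1 m l, inX (TH a),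
    conjpair (TH a) (b^-1 - evenG R m l) &
    reduced (TH a) (b^-1 - evenG R m l) 1].
Proof.
move=> aX cp red; have [na _ _] := cp; have [nb _ _] := conjpair_sym cp.
have a0 := Qi_neq0 na; have b0 := Qi_neq0 nb.
have [m [l [TE d X' _]]] := TH_irr na; exists m, l; split=> //.
  by rewrite TE; apply: conjpair_sub; [exact: Qi_ev|exact: conjpair_inv].
(* Scaling by [b] clears the denominator and gives the homogeneous pair produced by
   [reduced_step]. *)
rewrite TE; apply/(reducedZ _ _ _ b0); rewrite mulrBr divff // mulr1 [b * _]mulrC.
exact: reduced_step a0 aX (inX_sqn_lt1 aX na) d red.
Qed.

Lemma conj_reduced_TH a : conj_reduced a -> conj_reduced (TH a).
Proof.
move=> [b [aX cp red]]; have [m [l [_ _ ? ? ?]]] := conj_reduced_step aX cp red.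
by exists (b^-1 - evenG R m l).
Qed.

Lemma conj_reduced_iter a n : conj_reduced a -> conj_reduced (iter n (@TH R) a).
Proof. by move=> ga; elim: n => // n /conj_reduced_TH. Qed.

Lemma TH_inj a a' : conj_reduced a -> conj_reduced a' -> TH a = TH a' -> a = a'.
Proof.
move=> [b [aX cp red]] [b' [aX' cp' red']] e.
have [na _ _] := cp; have [na' _ _] := cp'.
have [m [l [TE d _ c1 _]]] := conj_reduced_step aX cp red.
have [m' [l' [TE' d' _ c2 _]]] := conj_reduced_step aX' cp' red'.
have eb : b^-1 - evenG R m l = b'^-1 - evenG R m' l'.
  by apply: conjpair_uniq c1 _; rewrite e.
have ea : a^-1 - evenG R m l = a'^-1 - evenG R m' l' by rewrite -TE -TE'.
have [mE lE] : (m, l) = (m', l').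
  apply: digit_inj d d' ea eb => //; rewrite ?Qi_neq0 //.
    exact: reduced_sqn_gt1 cp red.
  exact: reduced_sqn_gt1 cp' red'.
by move: ea; rewrite mE lE => /addIr/invr_inj.
Qed.

Lemma iter_TH_inj a n k : conj_reduced a ->
  iter (n + k) (@TH R) a = iter n (@TH R) a -> iter k (@TH R) a = a.
Proof.
move=> ga; elim: n => [//|n IH] /=; rewrite ?addSn /= => e.
by apply: IH; apply: TH_inj e; exact: conj_reduced_iter.
Qed.
End Orbit.

(** * Quadratic forms along an orbit *)

Section Forms.
Variable R : realType.
Local Notation Re := (@complex.Re R).
Local Notation Im := (@complex.Im R).
Implicit Types (z a b A B C : R[i]) (n : nat).

(** Vieta's formulas for [A X^2 + B X + C] over Z[i] with roots [a] and [b]. *)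
Definition is_form a b A B C := [/\ gauss_int A, gauss_int B & gauss_int C] /\
  [/\ A != 0, A * (a + b) = - B & A * (a * b) = C].

(** The substitution [X = 1 / (Y + e)], cleared of denominators. *)
Lemma is_form_step a b A B C e : gauss_int e -> a != 0 -> b != 0 -> is_form a b A B C ->
  is_form (a^-1 - e) (b^-1 - e) C (B + 2 * e * C) (A + B * e + C * e ^+ 2).
Proof.
move=> ge a0 b0 [[gA gB gC] [A0 hs hp]].
have BE : B = - (A * (a + b)) by rewrite hs opprK.
split.
  split=> //.
    by apply: gaussD => //; do 2?apply: gaussM => //; exact: (gauss_nat R 2).
  by apply: gaussD; [apply: gaussD|] => //; apply: gaussM => //; rewrite expr2; apply: gaussM.
split; first by rewrite -hp !mulf_neq0.
  by rewrite BE -hp; field; rewrite ?a0 ?b0.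
by rewrite BE -hp; field; rewrite ?a0 ?b0.
Qed.

Lemma form_ex a b : conjpair a b -> exists A B C, is_form a b A B C.
Proof.
move=> [_ /Qi_fraction[s [d [gs gd d0 sE]]] /Qi_fraction[t [d' [gt gd' d0' tE]]]].
exists (d * d'), (- (s * d')), (d * t); split.
  split; first exact: gaussM.
    by apply: gaussN; exact: gaussM.
  exact: gaussM.
split; first by rewrite mulf_neq0.
  by rewrite sE; field.
by rewrite tE; field.
Qed.

(** The discriminant is [A^2 (a - b)^2], and [|a| <= 15 / 16], [|b| >= 1] give [|a - b| >= 1 / 16];
    this bounds [A]. Writing [a + b = 2 a + (b - a)] then bounds [B = - A (a + b)], with
    [7 * 256 + 2 <= 3000]. *)
Lemma form_bound a b A B C : is_form a b A B C -> sqn a <= 7 / 8 -> 1 <= sqn b ->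
  let K := 3000 * (1 + sqn (B ^+ 2 - 4 * A * C)) in sqn A <= K /\ sqn B <= K.
Proof.
move=> [_ [A0 hs hp]] a1 b1 K.
have BE : B = - (A * (a + b)) by rewrite hs opprK.
set E := sqn (B ^+ 2 - 4 * A * C).
have EE : E = (sqn A * sqn (b - a)) ^+ 2.
  rewrite /E (_ : B ^+ 2 - 4 * A * C = (A * (b - a)) * (A * (b - a))).
    by rewrite !sqnM expr2.
  by rewrite BE -hp; ring.
have E0 : 0 <= E by rewrite sqn_ge0.
have A1 := sqn_ge0 A; have d1 := sqn_ge0 (b - a).
have AdE : sqn A * sqn (b - a) <= 1 + E.
  have : 0 <= (1 - sqn A * sqn (b - a)) ^+ 2 by rewrite sqr_ge0.
  rewrite EE => h; nra.
have dlow : 1 / 256 <= sqn (b - a).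
  have h1 : 1 <= `|b - a| + `|a|.
    apply: le_trans (ler_normD _ _); rewrite subrK.
    by rewrite norm_ge1.
  have h2 : `|a| <= (15 / 16)%:C.
    rewrite norm_sqn lecR -[leRHS]ger0_norm ?divr_ge0 // -sqrtr_sqr.
    by rewrite ler_sqrt ?exprn_ge0 ?divr_ge0 //; lra.
  have h3 : 1 / 16 <= Num.sqrt (sqn (b - a)).
    have := le_trans h1 (lerD (lexx _) h2); rewrite norm_sqn -rmorphD /=.
    by rewrite -[1]/(1%:C) lecR; lra.
  have h4 := sqr_sqrtr d1; nra.
have sA : sqn A <= 256 * (1 + E).
  have : sqn A * (1 / 256) <= sqn A * sqn (b - a) by rewrite ler_wpM2l.
  lra.
rewrite /K -/E; split; first lra.
have par : sqn (a + b) <= 2 * sqn (2 * a) + 2 * sqn (b - a).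
  rewrite /sqn !ReImE -subr_ge0.
  set u := Re a; set v := Im a; set u' := Re b; set v' := Im b.
  rewrite (_ : _ - _ = (3 * u - u') ^+ 2 + (3 * v - v') ^+ 2); last by ring.
  by rewrite addr_ge0 ?sqr_ge0.
have s2 : sqn (2 * a) = 4 * sqn a by rewrite /sqn !ReImE; ring.
rewrite BE sqnN sqnM.
have : sqn A * sqn (a + b) <= sqn A * (7 + 2 * sqn (b - a)).
  by rewrite ler_wpM2l //; rewrite s2 in par; lra.
lra.
Qed.

(** [A], [B] and the discriminant determine [C], hence the two roots; [a'] is not [b] because
    [|a'| < 1 < |b|]. *)
Lemma form_det a b a' b' A B C C' : conjpair a b ->
  is_form a b A B C -> is_form a' b' A B C' -> B ^+ 2 - 4 * A * C = B ^+ 2 - 4 * A * C' ->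
  sqn a' < 1 -> 1 < sqn b -> a' = a.
Proof.
move=> cp [_ [A0 hs hp]] [_ [_ hs' hp']] eD a1 b1.
have eC : C = C'.
  move/addrI: eD => /oppr_inj/(mulfI _); apply.
  by rewrite mulf_neq0 // pnatr_eq0.
have es : a + b = a' + b' by apply: (mulfI A0); rewrite hs hs'.
have ep : a * b = a' * b' by apply: (mulfI A0); rewrite hp hp'.
have : (a' - a) * (a' - b) = 0.
  rewrite (_ : _ * _ = a' ^+ 2 - a' * (a + b) + a * b); last by ring.
  by rewrite es ep; ring.
move/eqP; rewrite mulf_eq0 !subr_eq0 => /orP[/eqP//|/eqP e].
by rewrite e in a1; have := lt_trans a1 b1; rewrite ltxx.
Qed.

(** As [pc z] and [qc z] are at most 1 in absolute value, both squares are at least [3 / 4], and [e]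
    is the vertex with the same signs. The last inequality is what makes [1 / |z - e|^2] drop by at
    least 1 in [vertex_escape]. *)
Lemma near_vertex z : inX z -> 7 / 8 < sqn z -> exists e : R[i],
  [/\ gauss_int e, gauss_int e^-1, sqn e = 1, sqn (z - e) <= 1 / 16 &
    sqn z <= 1 - sqn (z - e)].
Proof.
have sq (x : R) : 3 / 4 <= x ^+ 2 -> 0 <= x -> x <= 1 ->
    (x - 1) ^+ 2 <= 1 / 16 /\ (x - 1) ^+ 2 <= 1 - x.
  move=> h h0 h1; have h2 : 3 / 4 <= x by nra.
  by split; nra.
have gi : gauss_int ('i : R[i]) by apply/gaussP; exists 0, 1; rewrite !ReImE.
have g1 := gauss1 R.
have si : sqn ('i : R[i]) = 1 by rewrite /sqn !ReImE; lra.
have iV : ('i : R[i])^-1 = - 'i.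
  have i0 : ('i : R[i]) != 0 by rewrite -sqn_gt0 /sqn !ReImE; lra.
  by apply: (mulfI i0); rewrite divff // mulrN -expr2 sqr_i opprK.
move=> [] + + z1; rewrite !ler_norml => /andP[p1 p2] /andP[q1 q2].
have p3 : 3 / 4 <= pc z ^+ 2.
  by move: z1; rewrite sqn_pq => z1; nra.
have q3 : 3 / 4 <= qc z ^+ 2.
  by move: z1; rewrite sqn_pq => z1; nra.
have fin (e : R[i]) : gauss_int e -> gauss_int e^-1 -> sqn e = 1 ->
    (pc z - pc e) ^+ 2 <= 1 / 16 -> (pc z - pc e) ^+ 2 <= 1 - pc z * pc e ->
    (qc z - qc e) ^+ 2 <= 1 / 16 -> (qc z - qc e) ^+ 2 <= 1 - qc z * qc e ->
    exists e : R[i], [/\ gauss_int e, gauss_int e^-1, sqn e = 1, sqn (z - e) <= 1 / 16 &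
    sqn z <= 1 - sqn (z - e)].
  move=> ge ge' e1 h1 h2 h3 h4; exists e; split=> //.
    by rewrite sqn_pq !pcB !qcB; lra.
  by rewrite !sqn_pq !pcB !qcB; move: e1; rewrite sqn_pq => e1; lra.
have [pp|pn] := leP 0 (pc z); have [qp|qn] := leP 0 (qc z).
- have [h1 h2] := sq _ p3 pp p2; have [h3 h4] := sq _ q3 qp q2.
  have [ep eq] : pc (1 : R[i]) = 1 /\ qc (1 : R[i]) = 1 by rewrite /pc /qc !ReImE; lra.
  have gV : gauss_int (1 : R[i])^-1 by rewrite invr1.
  by apply: fin g1 gV (sqn1 R) _ _ _ _; rewrite ?ep ?eq; lra.
- have [h1 h2] := sq _ p3 pp p2; have [|||h3 h4] := sq (- qc z); rewrite ?sqrrN; [lra..|].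
  have [ep eq] : pc ('i : R[i]) = 1 /\ qc ('i : R[i]) = -1 by rewrite /pc /qc !ReImE; lra.
  have gV : gauss_int ('i : R[i])^-1 by rewrite iV; exact: gaussN.
  by apply: fin gi gV si _ _ _ _; rewrite ?ep ?eq; lra.
- have [h1 h2] := sq _ q3 qp q2; have [|||h3 h4] := sq (- pc z); rewrite ?sqrrN; [lra..|].
  have [ep eq] : pc (- 'i : R[i]) = -1 /\ qc (- 'i : R[i]) = 1 by rewrite /pc /qc !ReImE; lra.
  have gV : gauss_int (- 'i : R[i])^-1 by rewrite invrN iV opprK.
  have sNi : sqn (- 'i : R[i]) = 1 by rewrite sqnN.
  by apply: fin (gaussN gi) gV sNi _ _ _ _; rewrite ?ep ?eq; lra.
have [|||h1 h2] := sq (- qc z); rewrite ?sqrrN; [lra..|].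
have [|||h3 h4] := sq (- pc z); rewrite ?sqrrN; [lra..|].
have [ep eq] : pc (- 1 : R[i]) = -1 /\ qc (- 1 : R[i]) = -1 by rewrite /pc /qc !ReImE; lra.
have gV : gauss_int (- 1 : R[i])^-1 by rewrite invrN invr1; exact: gaussN.
have sN1 : sqn (- 1 : R[i]) = 1 by rewrite sqnN sqn1.
by apply: fin (gaussN g1) gV sN1 _ _ _ _; rewrite ?ep ?eq; lra.
Qed.

(* Near a vertex [e] of the square the map is parabolic: it sends [e] to another
   vertex [e'] and decreases [1 / |z - e| ^ 2] by at least 1. *)
Lemma vertex_escape (x e : nat -> R[i]) :
  (forall n, [/\ gauss_int (e n), gauss_int (e n)^-1, sqn (e n) = 1,
    sqn (x n - e n) <= 1 / 16 & sqn (x n) <= 1 - sqn (x n - e n)]) ->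
  (forall n, [/\ x n != 0, x n != e n, 7 / 8 < sqn (x n) &
     gauss_int ((x n)^-1 - x n.+1)]) -> False.
Proof.
move=> he hx.
have step n : sqn (x n.+1 - e n.+1) = sqn (x n - e n) / sqn (x n).
  have [ge ge' e1 d1 d2] := he n; have [x0 _ x1 gx] := hx n.
  have [ge2 _ _ d1' _] := he n.+1.
  have e0 : e n != 0 by rewrite -sqn_gt0 e1.
  have sE : sqn ((x n)^-1 - (e n)^-1) = sqn (x n - e n) / sqn (x n).
    rewrite -sqnV -sqnM -[RHS]mul1r -[1 in RHS](invr1) -e1 -sqnV -sqnM -sqnN.
    by congr sqn; field; rewrite ?x0 ?e0.
  (* [x n.+1 - e n.+1] and [1 / x n - 1 / e n] differ by a Gaussian integer. Their squared moduli
     are at most [1 / 16] and [1 / 14], so this integer is 0. *)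
  rewrite -sE; congr sqn; apply/eqP; rewrite eq_sym -subr_eq0; apply/eqP.
  apply: gauss_sqn_lt1.
    rewrite (_ : _ - _ = (x n)^-1 - x n.+1 - (e n)^-1 + e n.+1); last by ring.
    by apply: gaussD => //; exact: gaussB.
  have par (u v : R[i]) : sqn (u - v) <= 2 * sqn u + 2 * sqn v.
    rewrite /sqn !ReImE -subr_ge0.
    rewrite (_ : _ - _ = (Re u + Re v) ^+ 2 + (Im u + Im v) ^+ 2); last by ring.
    by rewrite addr_ge0 ?sqr_ge0.
  apply: le_lt_trans (par _ _) _; rewrite sE.
  have : sqn (x n - e n) / sqn (x n) <= 1 / 14.
    by rewrite ler_pdivrMr; lra.
  lra.
pose u n := (sqn (x n - e n))^-1.
have u0 n : 0 < u n.
  by have [_ h _ _] := hx n; rewrite invr_gt0 sqn_gt0 subr_eq0.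
have us n : u n.+1 <= u n - 1.
  have [_ h h' _] := hx n; have [_ _ _ _ d2] := he n.
  have d0 : 0 < sqn (x n - e n) by rewrite sqn_gt0 subr_eq0.
  rewrite /u step invf_div ler_pdivrMr // mulrBl mulVf ?gt_eqF // mul1r.
  exact: d2.
have un n : u n <= u 0%N - n%:R.
  elim: n => [|n IH]; first by rewrite subr0.
  by have := us n; rewrite -natr1; lra.
have := un (Num.bound (u 0%N)); have := u0 (Num.bound (u 0%N)).
have := archi_boundP (ltW (u0 0%N)); lra.
Qed.
End Forms.

(** * Recurrence away from the vertices and the pigeonhole principle *)

Section Finite.
Variable R : realType.
Implicit Types (w a b A B C : R[i]) (m l : int) (k n : nat).
Local Notation orb a n := (iter n (@TH R) a).

Lemma leaves_vertices a N : inX a -> ~ Qi a ->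
  exists2 n, (N <= n)%N & sqn (orb a n) <= 7 / 8.
Proof.
move=> aX na; apply: contrapT => no.
have far n : 7 / 8 < sqn (orb a (N + n)).
  by rewrite ltNge; apply/negP => h; apply: no; exists (N + n)%N; rewrite ?leq_addr.
have orbX n := iter_TH_irr n aX na.
have [e he] := choice (fun n => near_vertex (proj1 (orbX (N + n)%N)) (far n)).
apply: (vertex_escape he) => n; have [_ nx] := orbX (N + n)%N.
split=> //; first exact: Qi_neq0.
  by apply/eqP => xe; apply: nx; rewrite xe; have [/gauss_Qi] := he n.
rewrite addnS iterS; have [m [l [-> _ _ _]]] := TH_irr nx.
by rewrite subKr; exact: gauss_ev.
Qed.

(** The pigeonhole principle for [#|T| + 1] elements of the infinite set [P], each chosen above the
    previous ones. *)
Lemma recurrent_repeat (T : finType) (P : set nat) (f : nat -> T) :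
  (forall N, exists2 n, (N <= n)%N & P n) ->
  exists m n : nat, [/\ (m < n)%N, P m, P n & f m = f n].
Proof.
move=> Pinf.
have [s [us sP ss]] : exists s : seq nat,
    [/\ uniq s, forall n, n \in s -> P n & size s = #|T|.+1].
  elim: #|T|.+1 => [|k [s [us sP ss]]]; first by exists [::].
  have [n hn Pn] := Pinf (\max_(i <- s) i).+1.
  exists (n :: s); split=> /=; last by rewrite ss.
    rewrite us andbT; apply/negP => ns.
    have := @leq_bigmax_seq _ s xpredT id n ns isT; rewrite leqNgt => /negP; apply.
    exact: hn.
  by move=> i; rewrite inE => /predU1P[->|/sP].
have : ~ {in s &, injective f}.
  move=> fi; have := max_card (mem [seq f i | i <- s]).
  have /card_uniqP -> : uniq [seq f i | i <- s] by rewrite map_inj_in_uniq.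
  by rewrite size_map ss ltnn.
move=> /existsNP[m /existsNP[n]] /not_implyP[ms /not_implyP[ns /not_implyP[e ne]]].
have [mn|nm|//] := ltngtP m n.
  by exists m, n; split=> //; exact: sP.
by exists n, m; split=> //; exact: sP.
Qed.

Lemma conj_reduced_form_orbit a : conj_reduced a -> exists E : R[i], forall n, exists b A B C,
  [/\ conjpair (orb a n) b, reduced (orb a n) b 1, is_form (orb a n) b A B C &
    B ^+ 2 - 4 * A * C = E].
Proof.
move=> [b [aX cp red]]; have [A [B [C fm]]] := form_ex cp.
exists (B ^+ 2 - 4 * A * C) => n.
suff [b' [A' [B' [C' [c r f e]]]]] : exists b A' B' C',
    [/\ conjpair (orb a n) b, reduced (orb a n) b 1, is_form (orb a n) b A' B' C' &
    B' ^+ 2 - 4 * A' * C' = B ^+ 2 - 4 * A * C] by exists b', A', B', C'.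
elim: n => [|n [b' [A' [B' [C' [c r f e]]]]]]; first by exists b, A, B, C.
have na : ~ Qi a by case: cp.
have [xX nx] := iter_TH_irr n aX na; have [nb _ _] := conjpair_sym c.
have [m [l [TE _ _ c' r']]] := conj_reduced_step xX c r.
exists (b'^-1 - evenG R m l), C', (B' + 2 * evenG R m l * C'),
  (A' + B' * evenG R m l + C' * evenG R m l ^+ 2); split=> //.
  by rewrite iterS TE; apply: is_form_step f; rewrite ?Qi_neq0 //; exact: gauss_ev.
by rewrite -e; ring.
Qed.

(** Indexes the Gaussian integers of bounded modulus by a finite type: coordinates between [- N] and
    [N] are shifted by [N]. *)
Lemma gauss_bounded (K : R) : exists N : nat, forall A, gauss_int A -> sqn A <= K ->
  exists s t : 'I_N.*2.+1, A = (s%:Z - N%:Z)%:~R +i* (t%:Z - N%:Z)%:~R.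
Proof.
pose N := Num.bound `|K|.
have KN : K < N%:R by rewrite (le_lt_trans (ler_norm K)) // archi_boundP.
exists N => A /gaussP[x [y [xE yE]]] AK.
have idx (v w : int) : sqn A = v%:~R ^+ 2 + w%:~R ^+ 2 ->
    exists s : 'I_N.*2.+1, s%:Z - N%:Z = v.
  move=> e; have hv : v ^+ 2 < N%:Z.
    rewrite -(ltr_int R) rmorphXn /= -pmulrn.
    apply: le_lt_trans KN; apply: le_trans AK; rewrite e.
    by rewrite lerDl sqr_ge0.
  have h1 : - N%:Z < v by nia.
  have h2 : v < N%:Z by nia.
  have h3 : (absz (v + N%:Z)%R < N.*2.+1)%N by clear -h1 h2; lia.
  by exists (Ordinal h3) => /=; clear -h1 h2; lia.
have [|s sE] := idx x y; first by rewrite /sqn xE yE.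
have [|t tE] := idx y x; first by rewrite /sqn xE yE addrC.
by exists s, t; apply: complexP; rewrite !ReImE ?sE ?tE.
Qed.

Lemma conj_reduced_repeat a : conj_reduced a -> exists m n : nat, (m < n)%N /\ orb a m = orb a n.
Proof.
move=> ga; have [b0 [aX [na _ _] _]] := ga.
have [E hE] := conj_reduced_form_orbit ga.
have [N hN] := gauss_bounded (3000 * (1 + sqn E)).
pose low n := sqn (orb a n) <= 7 / 8.
pose G (s t : 'I_N.*2.+1) : R[i] := (s%:Z - N%:Z)%:~R +i* (t%:Z - N%:Z)%:~R.
have code n : exists c : ('I_N.*2.+1 * 'I_N.*2.+1) * ('I_N.*2.+1 * 'I_N.*2.+1),
    low n -> exists b C, [/\ conjpair (orb a n) b, 1 < sqn b,
      is_form (orb a n) b (G c.1.1 c.1.2) (G c.2.1 c.2.2) C &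
      G c.2.1 c.2.2 ^+ 2 - 4 * G c.1.1 c.1.2 * C = E].
  (* The code carries information only at the times when the orbit is away from the vertices;
     elsewhere it is a dummy value. *)
  have [lo|nlo] := pselect (low n); last by exists ((ord0, ord0), (ord0, ord0)).
  have [b [A [B [C [cp red fm e]]]]] := hE n.
  have b1 := reduced_sqn_gt1 (proj1 (iter_TH_irr n aX na)) cp red.
  have [] := form_bound fm lo (ltW b1); rewrite e => hA hB.
  have [[gA gB _] _] := fm.
  have [s [t AE]] := hN A gA hA; have [s' [t' BE]] := hN B gB hB.
  exists ((s, t), (s', t')) => _; exists b, C => /=.
  by rewrite /G -AE -BE.
have [c hc] := choice code.
have [m [n [mn lm ln e]]] := recurrent_repeat c (fun k => leaves_vertices k aX na).
exists m, n; split=> //; have [b [C [cp b1 fm eE]]] := hc m lm.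
have [b' [C' [cp' b1' fm' eE']]] := hc n ln; rewrite -e in fm' eE'.
apply/esym; apply: form_det cp fm fm' _ _ b1; first by rewrite eE eE'.
by have [xX nx] := iter_TH_irr n aX na; exact: inX_sqn_lt1.
Qed.

Lemma conj_reduced_purely_periodic a : conj_reduced a -> purely_periodic (hurwitz_seq a).
Proof.
move=> ga; have [b0 [aX [na _ _] _]] := ga.
have hs n := hurwitz_seq_irr n aX na.
split=> [n|]; first by rewrite hs.
have [m [n [mn e]]] := conj_reduced_repeat ga.
exists (n - m)%N; first by rewrite subn_gt0.
have per : orb a (n - m) = a.
  by apply: (iter_TH_inj (n := m) ga); rewrite subnKC // ltnW.
by move=> k; rewrite !hs iterD per.
Qed.
End Finite.

(** * Periodic orbits *)

Section Main.
Variable R : realType.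
Implicit Types (z a b x y c mu A B C D : R[i]) (m l M L : int) (k n j : nat).
Local Notation orb a n := (iter n (@TH R) a).

(** Over a period this is the eigenvalue at [a] of the matrix in [orbit_matrix]. *)
Definition orbprod a n : R[i] := \prod_(j < n) orb a j.

Lemma orbprodS a n : orbprod a n.+1 = orbprod a n * orb a n.
Proof. by rewrite /orbprod big_ord_recr. Qed.

Lemma orbprod_neq0 a n : inX a -> ~ Qi a -> orbprod a n != 0.
Proof.
move=> aX na; elim: n => [|n IH]; first by rewrite /orbprod big_ord0 oner_neq0.
rewrite orbprodS mulf_neq0 //; apply: Qi_neq0.
by have [] := iter_TH_irr n aX na.
Qed.

Lemma orbprod_sqn_lt1 a n : inX a -> ~ Qi a -> (0 < n)%N -> sqn (orbprod a n) < 1.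
Proof.
move=> aX na; elim: n => [//|n IH] _; rewrite orbprodS sqnM.
have [xX nx] := iter_TH_irr n aX na; have x1 := inX_sqn_lt1 xX nx.
case: n IH x1 {xX nx} => [|n] IH x1; first by rewrite /orbprod big_ord0 sqn1 mul1r.
by apply: mulr_ilt1 => //; rewrite ?sqn_ge0 // IH.
Qed.

Lemma orbprod_period a i n : orb a i = a -> orbprod a (n + i) = orbprod a n * orbprod a i.
Proof.
move=> per; elim: n => [|n IH]; first by rewrite {2}/orbprod big_ord0 mul1r.
by rewrite addSn !orbprodS IH iterD per; ring.
Qed.

(* The first column of the matrix follows the orbit of the point at infinity
   under the natural extension, hence the condition [reduced]. *)
Lemma orbit_matrix a n : inX a -> ~ Qi a -> exists A B C D,
  [/\ [/\ gauss_int A, gauss_int B, gauss_int C & gauss_int D],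
    A != 0, (A * D - B * C) ^+ 2 = 1, reduced (orb a n) A C &
    A * a + B = orbprod a n * orb a n /\ C * a + D = orbprod a n].
Proof.
move=> aX na; elim: n => [|n [A [B [C [D [[gA gB gC gD] A0 det red [eA eC]]]]]]].
  (* The identity matrix: its first column [(1, 0)] is the point at infinity, for which the
     conditions of [reduced] have left side 0. *)
  exists 1, 0, 0, 1; have [g1 g0] := (gauss1 R, gauss0 R); split=> //.
  - by ring.
  - split; first by rewrite sqn0 sqn1.
    by move=> M L _ _; rewrite sqn0 sqn_ge0.
  by rewrite /orbprod big_ord0; split; rewrite /=; ring.
have [xX nx] := iter_TH_irr n aX na; have x0 := Qi_neq0 nx.
have [m [l [TE d _ _]]] := TH_irr nx.
have red' := reduced_step x0 xX (inX_sqn_lt1 xX nx) d red.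
exists (C - evenG R m l * A), (D - evenG R m l * B), A, B; split.
- by split=> //; apply: gaussB => //; apply: gaussM => //; exact: gauss_ev.
- by rewrite -sqn_gt0; apply: lt_le_trans (proj1 red'); rewrite sqn_gt0.
- by rewrite -det; ring.
- by rewrite iterS TE.
rewrite orbprodS iterS TE; split=> //.
transitivity ((C * a + D) - evenG R m l * (A * a + B)); first by ring.
by rewrite eA eC mulrBr -[X in _ = X - _]mulrA divff // mulr1; ring.
Qed.

Lemma sqn_small (r d : R) : 0 <= r < 1 -> 0 < d -> exists2 k, (0 < k)%N & r ^+ k < d.
Proof.
move=> /andP[r0 r1] d0.
have /cvgrPdist_lt/(_ _ d0)[N _ hN] : (GRing.exp r : R^nat) @ \oo --> (0 : R).
  by apply: cvg_expr; rewrite ger0_norm.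
exists N.+1 => //; have := hN N.+1 (leqnSn N).
by rewrite /= sub0r normrN ger0_norm // exprn_ge0.
Qed.

(** The limit of [|e - 1| <= |e x - y|] as [e] tends to 0. *)
Lemma sqn_limit_ge1 x y : (forall d : R, 0 < d -> exists2 e : R[i], sqn e < d &
  sqn (e - 1) <= sqn (e * x - y)) -> 1 <= sqn y.
Proof.
move=> H; rewrite leNgt; apply/negP => y1.
have ny : Num.sqrt (sqn y) < 1 by rewrite -sqrtr1 ltr_sqrt.
have nx := sqrtr_ge0 (sqn x).
(* With [|e| < h] the error [|e| (1 + |x|)] is below half of the gap [1 - |y|]. *)
pose h := (1 - Num.sqrt (sqn y)) / (2 * (1 + Num.sqrt (sqn x))).
have hE : h * (2 * (1 + Num.sqrt (sqn x))) = 1 - Num.sqrt (sqn y).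
  by rewrite /h divfK // gt_eqF //; lra.
have h0 : 0 < h by rewrite /h divr_gt0; lra.
have [e e1 e2] := H (h ^+ 2) (exprn_gt0 2 h0).
have ne : Num.sqrt (sqn e) < h.
  by rewrite -[ltRHS]gtr0_norm // -sqrtr_sqr ltr_sqrt ?exprn_gt0.
have : 1 <= Num.sqrt (sqn y) + Num.sqrt (sqn e) * Num.sqrt (sqn x) + Num.sqrt (sqn e).
  rewrite -lecR !rmorphD rmorphM /= -!norm_sqn -normrM.
  have t1 : `|1 : R[i]| <= `|e - 1| + `|e|.
    by have := ler_normB e (e - 1); rewrite subKr [leRHS]addrC.
  have t2 : `|e * x - y| <= `|y| + `|e * x| by rewrite [leRHS]addrC ler_normB.
  rewrite normr1 in t1; apply: le_trans t1 _; rewrite lerD2r; apply: le_trans t2.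
  by rewrite norm_leE.
have := sqrtr_ge0 (sqn e); nra.
Qed.

(** The fixed point equation [C X^2 + (D - A) X - B = 0] is over Q(i), so [b] satisfies it too. Its
    sum and product of roots give [(C a + D) (C b + D) = A D - B C]. *)
Lemma matrix_fixed_conj a b A B C D mu : conjpair a b ->
  [/\ gauss_int A, gauss_int B, gauss_int C & gauss_int D] ->
  (A * D - B * C) ^+ 2 = 1 -> A * a + B = mu * a -> C * a + D = mu ->
  exists mu', [/\ (mu * mu') ^+ 2 = 1, A * b + B = mu' * b & C * b + D = mu'].
Proof.
move=> cp [gA gB gC gD] det eA eC.
have [||||hs hp] := conjpair_quad (x := C) (y := D - A) (z := - B) cp.
- exact: gauss_Qi.
- by apply: gauss_Qi; exact: gaussB.
- by apply: gauss_Qi; exact: gaussN.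
- have -> : C * a ^+ 2 + (D - A) * a - B = (C * a + D) * a - (A * a + B) by ring.
  by rewrite eA eC subrr.
exists (C * b + D); split=> //.
  rewrite -eC -det; congr (_ ^+ 2).
  transitivity (C * (C * (a * b)) + D * (C * (a + b)) + D ^+ 2); first by ring.
  by rewrite hs hp; ring.
apply/eqP; rewrite -subr_eq0; apply/eqP.
transitivity (C * (a * b) + B - (C * (a + b) + (D - A)) * b); first by ring.
by rewrite hs hp; ring.
Qed.

Lemma periodic_conj_reduced a i : inX a -> ~ Qi a -> (0 < i)%N -> orb a i = a -> conj_reduced a.
Proof.
move=> aX na i0 per.
have perk k : orb a (k * i) = a.
  by elim: k => // k IH; rewrite mulSn iterD IH per.
(* If [C = 0], then [D] is a Gaussian integer equal to [orbprod a n], which is nonzero of modulus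
   less than 1. *)
have Cn0 n A B C D : (0 < n)%N -> gauss_int D -> C * a + D = orbprod a n -> C != 0.
  move=> n0 gD e; apply: contraTneq (orbprod_neq0 n aX na) => C0.
  have De : D = orbprod a n by rewrite -e C0 mul0r add0r.
  rewrite negbK -De; apply/eqP; apply: gauss_sqn_lt1 => //.
  by rewrite De; exact: orbprod_sqn_lt1.
have [b cp] : exists b, conjpair a b.
  have [A [B [C [D [[gA gB gC gD] _ _ _ [eA eC]]]]]] := orbit_matrix i aX na.
  have C0 := Cn0 i A B C D i0 gD eC.
  rewrite per -eC in eA.
  (* The other root of [C X^2 + (D - A) X - B]. *)
  exists ((A - D) / C - a); split=> //.
    by rewrite addrC subrK; apply: Qi_div; apply: gauss_Qi => //; exact: gaussB.
  rewrite (_ : _ * _ = - B / C).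
    by apply: Qi_div; apply: gauss_Qi => //; exact: gaussN.
  apply: (mulIf C0); rewrite divfK // mulrBr mulrBl -mulrA divfK //.
  apply/eqP; rewrite -subr_eq0; apply/eqP.
  transitivity ((A * a + B) - (C * a + D) * a); first by ring.
  by rewrite eA subrr.
exists b; split=> //.
have ab : a - b != 0.
  rewrite subr_eq0; apply/eqP => e; have [_ hs _] := cp; apply: na.
  rewrite (_ : a = (a + b) / 2%:R); last by rewrite -e; field.
  by apply: Qi_div => //; exact/gauss_Qi/gauss_nat.
have rho : 0 <= sqn (orbprod a i) ^+ 2 < 1.
  by rewrite exprn_ge0 ?sqn_ge0 //= expr_lt1 ?sqn_ge0 // orbprod_sqn_lt1.
(* Any bound [|A / C - c| >= 1] shared by all second points reduced with [a] passes to [b], the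
   limit of the orbit of infinity along the multiples of the period. *)
have limit c (P : forall A C, reduced a A C -> sqn C <= sqn (A - c * C)) :
    1 <= sqn (b - c).
  apply: (@sqn_limit_ge1 (a - c)) => d d0.
  have [k k0 hk] := sqn_small rho d0.
  have [A [B [C [D [g A0 det red [eA eC]]]]]] := orbit_matrix (k * i) aX na.
  rewrite perk in red eA; have h := P _ _ red.
  have [mu' [mm eA' eC']] := matrix_fixed_conj cp g det eA eC.
  set mu := orbprod a (k * i) in eA eC mm.
  have mu0' : mu' != 0.
    by apply: contra_eq_neq mm => ->; rewrite mulr0 expr0n /= eq_sym oner_neq0.
  have smm : sqn mu * sqn mu' = 1.
    have : sqn (mu * mu') ^+ 2 = 1 by rewrite expr2 -sqnM -expr2 mm sqn1.
    by rewrite -sqnM => /eqP; rewrite sqrf_eq1 => /orP[/eqP//|/eqP e];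
      have := sqn_ge0 (mu * mu'); rewrite e; lra.
  (* Since [|mu mu'| = 1], the ratio of the eigenvalues has modulus [|mu|^2], and its [sqn] is the
     [k]-th power of the number bounded in [rho]. *)
  exists (mu / mu').
    apply: le_lt_trans hk; rewrite sqnM sqnV.
    have -> : (sqn mu')^-1 = sqn mu.
      by apply: (mulIf (x := sqn mu')); rewrite ?sqn_eq0 // mulVf ?sqn_eq0.
    have -> : sqn mu = sqn (orbprod a i) ^+ k.
      rewrite /mu; elim: (k) => [|k' IH]; first by rewrite /orbprod big_ord0 sqn1.
      by rewrite mulSn addnC orbprod_period // sqnM IH exprSr.
    by rewrite exprAC expr2.
  (* [C] and [A - c C] are expressed by the eigenvalues: up to the common factor [mu' / (a - b)]
     they are the two sides that [sqn_limit_ge1] compares. *)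
  have ec : (mu / mu' - 1) * mu' = C * (a - b).
    by rewrite mulrBl divfK // mul1r -eC -eC'; ring.
  have ed : (mu / mu' * (a - c) - (b - c)) * mu' = (A - c * C) * (a - b).
    transitivity (mu / mu' * mu' * (a - c) - mu' * (b - c)); first by ring.
    rewrite divfK // !mulrBr -eA -eA' -eC -eC'; ring.
  rewrite -(ler_pM2r (x := sqn mu')) ?sqn_gt0 // -!sqnM ec ed !sqnM.
  by rewrite ler_pM2r ?sqn_gt0.
(* [c = 0] gives [|b| >= 1]; the units give the disc conditions. *)
split; first by rewrite sqn1 -[b]subr0; apply: limit => A C [h _]; rewrite mul0r subr0.
by move=> M L u lt; rewrite sqn1 mulr1; apply: limit => A C [_ h]; exact: h.
Qed.
End Main.

Theorem theorem6p1 (R : realType) (alpha : R[i]) (halpha : closure (squareX R) alpha) :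
  purely_periodic (hurwitz_seq alpha) <->
  quadratic_irrational alpha /\ Xtilde R (alpha, Some (conjQi alpha)).
Proof.
have aX : inX alpha by exact/closure_squareXE.
split=> [[inf [l l0 per]]|[/quadratic_conjpair cp /(Xtilde_reduced aX) red]].
  have na := nonterminating_irrational aX inf.
  have /(_ aX na l0)[|b [_ cp red]] := @periodic_conj_reduced R alpha l.
    by have := per 0%N; rewrite !hurwitz_seq_irr // => -[].
  have [qa ->] := conjpair_quadratic cp; split=> //.
  apply: reduced_Xtilde => //; exact: reduced_sqn_gt1 cp red.
by apply: conj_reduced_purely_periodic; exists (conjQi alpha).
Qed.
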